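(* Let $k$ be a commutative rig. To give a ($k$-linear) cartesian differential category is equally to give a cartesian $k\text{-Mod}^Q$-category. That is, the following two assignments (both leaving unchanged the objects, the hom-$k$-modules, the identities and the finite products) are mutually inverse: (a) a cartesian differential category $\mathcal{A}$ is sent to the cartesian $k\text{-Mod}^Q$-category with composition law $m\colon \mathcal{A}(B,C)\otimes Q\mathcal{A}(A,B)\to\mathcal{A}(A,C)$, $g\otimes\langle f_0,\dots,f_n\rangle\mapsto g^{(n)}\circ(f_0,\dots,f_n)$, where $g^{(n)}$ is the $n$th derivative of $g$; (b) a cartesian $k\text{-Mod}^Q$-category with composition $m$ is sent to the cartesian differential category with composition $g\circ f=m(g\otimes\langle f\rangle)$ and differential operator $\mathrm{D}f=m(f\otimes\langle\pi_0,\pi_1\rangle)$. Moreover, under this correspondence, the $\mathrm{D}$-linear maps correspond to the $k\text{-Mod}^Q$-linear ones.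
   Context: Fix a commutative rig (semiring) $k$; $k\text{-Mod}$ is the category of $k$-modules (commutative monoids with $k$-action) and $k$-linear maps, with its usual tensor product $\otimes$. **Cartesian differential categories.** A *left-$k$-linear category* is a category whose hom-sets are $k$-modules such that each precomposition function $(-)\circ f$ is $k$-linear. It is *cartesian* if it has finite products and the bijections $\mathcal{A}(A,B\times C)\to\mathcal{A}(A,B)\oplus\mathcal{A}(A,C)$ are $k$-linear. We write $h(x_1,\dots,x_n)$ for $h\circ(x_1,\dots,x_n)$. A *($k$-linear) cartesian differential category* is a cartesian left-$k$-linear category with operators $\mathrm{D}\colon\mathcal{A}(A,B)\to\mathcal{A}(A\times A,B)$ such that: (i) each $\mathrm{D}$ is $k$-linear; (ii) $\mathrm{D}f(x,\lambda v+\mu w)=\lambda\,\mathrm{D}f(x,v)+\mu\,\mathrm{D}f(x,w)$ for $\lambda,\mu\in k$; (iii) $\mathrm{D}(\pi_i)=\pi_i\pi_1\colon(A_0\times A_1)\times(A_0\times A_1)\to A_i$ for $i=0,1$; (iv) $\mathrm{D}(1_A)=\pi_1$; (v) $\mathrm{D}(gf)=\mathrm{D}g(f\pi_0,\mathrm{D}f)$; (vi) $\mathrm{D}(\mathrm{D}f)(x,r,0,v)=\mathrm{D}f(x,v)$; (vii) $\mathrm{D}(\mathrm{D}f)(x,r,s,0)=\mathrm{D}(\mathrm{D}f)(x,s,r,0)$. The *$n$th derivative* $f^{(n)}\colon A\times A^n\to B$ of $f\colon A\to B$ is defined by $f^{(0)}=f$ and $f^{(n)}(x_0,\dots,x_n)=\mathrm{D}(f^{(n-1)})(x_0,\dots,x_{n-1},x_n,0,\dots,0)$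 with $n-1$ zeros. A map $f\colon A\to B$ is *$\mathrm{D}$-linear* if $\mathrm{D}f(x,v)=f v$ for all $x,v\colon Z\to A$. **The comonad $Q$.** $QA=\bigoplus_{x\in A}\mathrm{Sym}(A)$, where $\mathrm{Sym}(A)=\bigoplus_n A^{\otimes n}/\mathfrak{S}_n$ is the free symmetric $k$-algebra. Write $\langle x_0,\dots,x_n\rangle\in QA$ for the image of $x_1\otimes\cdots\otimes x_n$ in the summand indexed by $x_0$; this is symmetric multilinear in $x_1,\dots,x_n$ but not in $x_0$, and such elements generate $QA$. Let $Qf\langle x_0,\dots,x_n\rangle=\langle f x_0,\dots,f x_n\rangle$. The counit $\varepsilon$ has $\langle x_0\rangle\mapsto x_0$, $\langle x_0,x_1\rangle\mapsto x_1$, $\langle x_0,\dots,x_n\rangle\mapsto0$ for $n\ge2$. The comultiplication is $\delta\langle x_0,\dots,x_n\rangle=\sum_{[n]=A_1|\dots|A_r}\langle\langle x_0\rangle,\langle x_{A_1}\rangle,\dots,\langle x_{A_r}\rangle\rangle$, the sum over unordered partitions of $[n]=\{1,\dots,n\}$ into non-empty subsets, with $\langle x_I\rangle=\langle x_0,x_{i_1},\dots,x_{i_s}\rangle$ for $I=\{i_1<\dots<i_s\}$. $Q$ is a monoidal comonad with $m_I\colon k\to Qk$, $1\mapsto\langle1\rangle$, and $m_\otimes\colon QA\otimes QB\to Q(A\otimes B)$ sending $\langle x_0,\dots,x_n\rangle\otimes\langle y_0,\dots,y_p\rangle$ to the sum, over all partial isomorphisms $\theta$ from $[n]$ to $[p]$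 (bijections $\theta\colon I\to J$ with $I\subseteq[n]$, $J\subseteq[p]$), of the element $\langle\cdots\rangle$ whose first entry is $x_0\otimes y_0$ and whose remaining entries are $x_i\otimes y_{\theta(i)}$ ($i\in I$), $x_i\otimes y_0$ ($i\in[n]\setminus I$), $x_0\otimes y_j$ ($j\in[p]\setminus J$). Its fusion map is $H=m_\otimes\circ(1\otimes\delta)\colon QX\otimes QY\to Q(X\otimes QY)$. ($Q$ is called in the paper the initial monoidal differential modality on $k\text{-Mod}$.) **$k\text{-Mod}^Q$-categories.** $k\text{-Mod}^Q$ denotes $k\text{-Mod}$ with the skew monoidal structure with tensor $A\otimes^QB=A\otimes QB$ and unit $k$, obtained by warping $\otimes$ by $Q$. Explicitly, a *$k\text{-Mod}^Q$-enriched category* consists of objects, hom-$k$-modules $\mathcal{A}(A,B)$, elements $\mathrm{id}_A\in\mathcal{A}(A,A)$ (equivalently $k$-linear maps $i\colon k\to\mathcal{A}(A,A)$), and $k$-linear maps $m\colon\mathcal{A}(B,C)\otimes Q\mathcal{A}(A,B)\to\mathcal{A}(A,C)$, with $m\circ(m\otimes1)=m\circ(1\otimes Qm)\circ(1\otimes H)$ on $\mathcal{A}(C,D)\otimes Q\mathcal{A}(B,C)\otimes Q\mathcal{A}(A,B)$ (associators suppressed), $m(\mathrm{id}_B\otimes t)=\varepsilon(t)$ for $t\in Q\mathcal{A}(A,B)$, and $m(g\otimes\langle\mathrm{id}_A\rangle)=g$. Its underlying category has hom-sets the underlying sets of the $\mathcal{A}(A,B)$, identities $\mathrm{id}_A$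 and composition $g\circ f=m(g\otimes\langle f\rangle)$. A *$k\text{-Mod}^Q$-linear map* $A\to_\ell B$ is a family of $k$-linear maps $g_X\colon\mathcal{A}(X,A)\to\mathcal{A}(X,B)$ with $g_X\circ m=m\circ(g_Y\otimes1)$ on $\mathcal{A}(Y,A)\otimes Q\mathcal{A}(X,Y)$; its underlying map is $g_A(\mathrm{id}_A)\in\mathcal{A}(A,B)$, which determines it, and a map $g\in\mathcal{A}(A,B)$ is called $k\text{-Mod}^Q$-linear if it is the underlying map of such a family. A $k\text{-Mod}^Q$-category is *cartesian* if it has a terminal object $1$ (each $\mathcal{A}(X,1)$ is the zero module) and binary products: for all $A,B$, an object $A\times B$ with $k\text{-Mod}^Q$-linear maps $\pi_0\colon A\leftarrow_\ell A\times B\to_\ell B\colon\pi_1$ each of whose components $\mathcal{A}(X,A)\leftarrow\mathcal{A}(X,A\times B)\to\mathcal{A}(X,B)$ is a product diagram in $k\text{-Mod}$. *)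

(* Defs.v *)
From HB Require Import structures.
From mathcomp Require Import boolp classical_sets cardinality fsbigop.
From mathcomp Require Import all_boot ssralg perm.

Set Implicit Arguments.
Unset Strict Implicit.
Unset Printing Implicit Defensive.

Import GRing.Theory.
Local Open Scope ring_scope.

Section KLinear.
Context {k : comPzSemiRingType}.

(* [semilinear] of ssralg as a proposition: [semilinear] itself lives in Type *)
Definition klinear (U V : lSemiModType k) (f : U -> V) : Prop :=
  (forall a x, f (a *: x) = a *: f x) /\ (forall x y, f (x + y) = f x + f y).

Lemma klinear_semilinear (U V : lSemiModType k) (f : U -> V) :
  klinear f -> semilinear f.
Proof. by case=> fZ fD; split. Qed.

Definition lin_of (U V : lSemiModType k) (f : U -> V) (Hf : klinear f) :
    {linear U -> V} :=
  HB.pack_for {linear U -> V} f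
    (GRing.isSemilinear.Build k U V *:%R f (klinear_semilinear Hf)).

Lemma lin_ofE (U V : lSemiModType k) (f : U -> V) (Hf : klinear f) x :
  lin_of Hf x = f x.
Proof. by []. Qed.

Lemma linear_klinear (U V : lSemiModType k) (f : {linear U -> V}) : klinear f.
Proof. by split=> [a x|x y]; rewrite ?linearZ ?linearD. Qed.

Lemma klinear0 (U V : lSemiModType k) : klinear (fun _ : U => 0 : V).
Proof. by split=> [a x|x y]; rewrite ?scaler0 ?addr0. Qed.

Lemma klinear_id (U : lSemiModType k) : klinear (fun x : U => x).
Proof. by []. Qed.

Lemma klinear_comp (U V W : lSemiModType k) (g : V -> W) (f : U -> V) :
  klinear g -> klinear f -> klinear (fun x => g (f x)).
Proof. by move=> [gZ gD] [fZ fD]; split=> [a x|x y]; rewrite ?fZ ?fD. Qed.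

Lemma klinearD (U V : lSemiModType k) (f g : U -> V) :
  klinear f -> klinear g -> klinear (fun x => f x + g x).
Proof.
move=> [fZ fD] [gZ gD]; split=> [a x|x y]; first by rewrite fZ gZ scalerDr.
by rewrite fD gD addrACA.
Qed.

Lemma klinearZ (U V : lSemiModType k) (b : k) (f : U -> V) :
  klinear f -> klinear (fun x => b *: f x).
Proof.
move=> [fZ fD]; split=> [a x|x y]; first by rewrite fZ !scalerA mulrC.
by rewrite fD scalerDr.
Qed.

Lemma klinear_sum (U V : lSemiModType k) I (r : seq I) (P : pred I)
    (f : I -> U -> V) :
  (forall i, P i -> klinear (f i)) -> klinear (fun x => \sum_(i <- r | P i) f i x).
Proof.
move=> Hf; split=> [a x|x y].
  by rewrite scaler_sumr; apply: eq_bigr => i /Hf[].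
by rewrite -big_split; apply: eq_bigr => i /Hf[].
Qed.

Lemma klinear_ext (U V : lSemiModType k) (f g : U -> V) :
  f =1 g -> klinear f -> klinear g.
Proof. by move=> /funext->. Qed.

End KLinear.

Section Quotient.
Context {k : comPzSemiRingType} {M : lSemiModType k} (R : M -> M -> Prop).

Inductive gcongr : M -> M -> Prop :=
| congr_gen u v : R u v -> gcongr u v
| congr_refl u : gcongr u u
| congr_sym u v : gcongr u v -> gcongr v u
| congr_trans u v w : gcongr u v -> gcongr v w -> gcongr u w
| congr_add u u' v v' : gcongr u u' -> gcongr v v' -> gcongr (u + v) (u' + v')
| congr_scale a u v : gcongr u v -> gcongr (a *: u) (a *: v).

Definition congrb (u v : M) : bool := `[< gcongr u v >].

Lemma congrb_refl : reflexive congrb.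
Proof. by move=> u; apply/asboolP; apply: congr_refl. Qed.
Lemma congrb_sym : symmetric congrb.
Proof. by move=> u v; apply/asboolP/asboolP; apply: congr_sym. Qed.
Lemma congrb_trans : transitive congrb.
Proof.
by move=> v u w /asboolP uv /asboolP vw; apply/asboolP; apply: congr_trans uv vw.
Qed.

Definition congr_equiv := EquivRel congrb congrb_refl congrb_sym congrb_trans.

Definition mquot := {eq_quot congr_equiv}%qT.

HB.instance Definition _ := Choice.on mquot.
HB.instance Definition _ := EqQuotient.on mquot.

Definition qcl (u : M) : mquot := \pi_mquot%qT u.

Lemma qclP u v : gcongr u v -> qcl u = qcl v.
Proof. by move=> uv; apply/eqmodP/asboolP. Qed.

Lemma qcl_congr u v : qcl u = qcl v -> gcongr u v.
Proof. by move=> /eqmodP/asboolP. Qed.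

Lemma qcl_repr (x : mquot) : qcl (repr x) = x.
Proof. exact: reprK. Qed.

Lemma repr_qcl u : gcongr (repr (qcl u)) u.
Proof. by apply: qcl_congr; rewrite qcl_repr. Qed.

Definition mq_zero : mquot := qcl 0.
Definition mq_add (x y : mquot) : mquot := qcl (repr x + repr y).
Definition mq_scale (a : k) (x : mquot) : mquot := qcl (a *: repr x).

Lemma mq_addE u v : mq_add (qcl u) (qcl v) = qcl (u + v).
Proof. by apply: qclP; apply: congr_add; apply: repr_qcl. Qed.
Lemma mq_scaleE a u : mq_scale a (qcl u) = qcl (a *: u).
Proof. by apply: qclP; apply: congr_scale; apply: repr_qcl. Qed.

Lemma mq_addA : associative mq_add.
Proof.
move=> x y z; rewrite -[x]qcl_repr -[y]qcl_repr -[z]qcl_repr !mq_addE.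
by rewrite addrA.
Qed.
Lemma mq_addC : commutative mq_add.
Proof. by move=> x y; rewrite /mq_add addrC. Qed.
Lemma mq_add0 : left_id mq_zero mq_add.
Proof. by move=> x; rewrite -[x]qcl_repr mq_addE add0r. Qed.

HB.instance Definition _ :=
  GRing.isNmodule.Build mquot mq_addA mq_addC mq_add0.

Lemma mq_scaleA a b x : mq_scale a (mq_scale b x) = mq_scale (a * b) x.
Proof. by rewrite -[x]qcl_repr !mq_scaleE scalerA. Qed.
Lemma mq_scale0 x : mq_scale 0 x = 0.
Proof. by rewrite -[x]qcl_repr !mq_scaleE scale0r. Qed.
Lemma mq_scale1 : left_id 1 mq_scale.
Proof. by move=> x; rewrite -[x]qcl_repr !mq_scaleE scale1r. Qed.
Lemma mq_scaleDr : right_distributive mq_scale +%R.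
Proof.
move=> a x y; rewrite -[x]qcl_repr -[y]qcl_repr.
by rewrite [qcl _ + qcl _]mq_addE !mq_scaleE [RHS]mq_addE scalerDr.
Qed.
Lemma mq_scaleDl x : {morph mq_scale^~ x : a b / a + b}.
Proof.
by move=> a b; rewrite -[x]qcl_repr !mq_scaleE [RHS]mq_addE scalerDl.
Qed.

HB.instance Definition _ :=
  GRing.Nmodule_isLSemiModule.Build k mquot
    mq_scaleA mq_scale0 mq_scale1 mq_scaleDr mq_scaleDl.

Lemma qcl_klinear : klinear (qcl : M -> mquot).
Proof. by split=> [a u|u v]; rewrite -?mq_scaleE -?mq_addE. Qed.

Definition qproj : {linear M -> mquot} := lin_of qcl_klinear.

Lemma qproj_gen u v : R u v -> qproj u = qproj v.
Proof. by move=> uv; apply: qclP; apply: congr_gen. Qed.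

Section Lift.
Context {V : lSemiModType k} (f : {linear M -> V}).
Hypothesis fR : forall u v, R u v -> f u = f v.

Lemma congr_lift u v : gcongr u v -> f u = f v.
Proof.
elim=> {u v} [u v /fR|u|u v _ ->|u v w _ -> _ ->|u u' v v' _ e1 _ e2|a u v _ e] //.
  by rewrite !linearD e1 e2.
by rewrite !linearZ e.
Qed.

Definition qlift_fun (x : mquot) : V := f (repr x).

Lemma qlift_qcl u : qlift_fun (qcl u) = f u.
Proof. by apply: congr_lift; apply: repr_qcl. Qed.

Lemma qlift_klinear : klinear qlift_fun.
Proof.
split=> [a x|x y]; rewrite -[x]qcl_repr.
  by rewrite [a *: _]mq_scaleE !qlift_qcl linearZ.
by rewrite -[y]qcl_repr [_ + _]mq_addE !qlift_qcl linearD.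
Qed.

Definition qlift : {linear mquot -> V} := lin_of qlift_klinear.

Lemma qliftE u : qlift (qproj u) = f u.
Proof. exact: qlift_qcl. Qed.

End Lift.

Lemma qext (V : lSemiModType k) (f g : {linear mquot -> V}) :
  (forall u, f (qproj u) = g (qproj u)) -> f =1 g.
Proof. by move=> fg x; rewrite -[x]qcl_repr; exact: fg. Qed.

End Quotient.

Section DirectSum.
Context {k : comPzSemiRingType} {I : choiceType} (M : I -> lSemiModType k).

Record dsum := DSum {
  dval :> forall i, M i;
  dval_fin : exists s : seq I, forall i, i \notin s -> dval i = 0 }.

Lemma dsumP (u v : dsum) : (forall i, u i = v i) -> u = v.
Proof.
case: u v => [u uP] [v vP] /= uv.
have e : u = v by apply: functional_extensionality_dep.
by case: _ / e vP => vP; congr DSum; apply: Prop_irrelevance.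
Qed.

HB.instance Definition _ := gen_eqMixin dsum.
HB.instance Definition _ := gen_choiceMixin dsum.

Lemma ds_zero_fin : exists s : seq I, forall i, i \notin s -> (0 : M i) = 0.
Proof. by exists [::]. Qed.
Definition ds_zero := DSum ds_zero_fin.

Lemma ds_add_fin (u v : dsum) :
  exists s : seq I, forall i, i \notin s -> u i + v i = 0.
Proof.
have [[s us] [t vt]] := (dval_fin u, dval_fin v); exists (s ++ t) => i.
by rewrite mem_cat negb_or => /andP[/us-> /vt->]; rewrite addr0.
Qed.
Definition ds_add (u v : dsum) := DSum (ds_add_fin u v).

Lemma ds_scale_fin (a : k) (u : dsum) :
  exists s : seq I, forall i, i \notin s -> a *: u i = 0.
Proof. by have [s us] := dval_fin u; exists s => i /us->; rewrite scaler0. Qed.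
Definition ds_scale a (u : dsum) := DSum (ds_scale_fin a u).

Lemma ds_addA : associative ds_add.
Proof. by move=> u v w; apply: dsumP => i /=; rewrite addrA. Qed.
Lemma ds_addC : commutative ds_add.
Proof. by move=> u v; apply: dsumP => i /=; rewrite addrC. Qed.
Lemma ds_add0 : left_id ds_zero ds_add.
Proof. by move=> u; apply: dsumP => i /=; rewrite add0r. Qed.

HB.instance Definition _ := GRing.isNmodule.Build dsum ds_addA ds_addC ds_add0.

Lemma ds_scaleA a b u : ds_scale a (ds_scale b u) = ds_scale (a * b) u.
Proof. by apply: dsumP => i /=; rewrite scalerA. Qed.
Lemma ds_scale0 u : ds_scale 0 u = 0.
Proof. by apply: dsumP => i /=; rewrite scale0r. Qed.
Lemma ds_scale1 : left_id 1 ds_scale.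
Proof. by move=> u; apply: dsumP => i /=; rewrite scale1r. Qed.
Lemma ds_scaleDr : right_distributive ds_scale +%R.
Proof. by move=> a u v; apply: dsumP => i /=; rewrite scalerDr. Qed.
Lemma ds_scaleDl u : {morph ds_scale^~ u : a b / a + b}.
Proof. by move=> a b; apply: dsumP => i /=; rewrite scalerDl. Qed.

HB.instance Definition _ :=
  GRing.Nmodule_isLSemiModule.Build k dsum
    ds_scaleA ds_scale0 ds_scale1 ds_scaleDr ds_scaleDl.

Lemma dvalD (u v : dsum) i : (u + v) i = u i + v i. Proof. by []. Qed.
Lemma dvalZ a (u : dsum) i : (a *: u) i = a *: u i. Proof. by []. Qed.
Lemma dval0 i : (0 : dsum) i = 0. Proof. by []. Qed.

Lemma dval_sum J (r : seq J) (F : J -> dsum) i :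
  (\sum_(j <- r) F j) i = \sum_(j <- r) F j i.
Proof.
by elim: r => [|j r IH]; rewrite ?big_nil ?big_cons // dvalD IH.
Qed.

Definition ds_single_fun i (m : M i) : forall j, M j :=
  fun j => if @eqP _ i j is ReflectT e then eq_rect i M m j e else 0.

Lemma ds_single_fin i (m : M i) :
  exists s : seq I, forall j, j \notin s -> ds_single_fun m j = 0.
Proof.
exists [:: i] => j; rewrite inE /ds_single_fun => /eqP ne.
by case: eqP => // e; case: ne.
Qed.

Definition ds_single i (m : M i) := DSum (ds_single_fin m).

Lemma ds_single_eq i (m : M i) : ds_single m i = m.
Proof.
by rewrite /= /ds_single_fun; case: eqP => // e; rewrite (eq_axiomK e).
Qed.

Lemma ds_single_neq i (m : M i) j : i != j -> ds_single m j = 0.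
Proof. by rewrite /= /ds_single_fun; case: eqP. Qed.

Lemma ds_single_klinear i : klinear (@ds_single i).
Proof.
split=> [a x|x y]; apply: dsumP => j; rewrite ?dvalZ ?dvalD;
  have [<-|ne] := eqVneq i j; rewrite ?ds_single_eq ?ds_single_neq //.
- by rewrite scaler0.
- by rewrite addr0.
Qed.

Definition dinj i : {linear M i -> dsum} := lin_of (ds_single_klinear i).

Lemma dinj_eq i (m : M i) : dinj i m i = m.
Proof. exact: ds_single_eq. Qed.

Lemma dinj_neq i (m : M i) j : i != j -> dinj i m j = 0.
Proof. exact: ds_single_neq. Qed.

Section Lift.
Context {V : lSemiModType k} (f : forall i, {linear M i -> V}).

Definition dlift_fun (u : dsum) : V := \sum_(i \in [set: I]) f i (u i).

Lemma dlift_seq (u : dsum) (s : seq I) : uniq s ->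
  (forall i, i \notin s -> u i = 0) -> dlift_fun u = \sum_(i <- s) f i (u i).
Proof.
move=> us su; rewrite (fsbig_seq _ _ us); apply/esym/fsbig_widen => //= i.
by case=> _ /= /negP/su->; rewrite linear0.
Qed.

Lemma dsum_supp2 (u v : dsum) : exists s : seq I, [/\ uniq s,
  forall i, i \notin s -> u i = 0 & forall i, i \notin s -> v i = 0].
Proof.
have [[s us] [t vt]] := (dval_fin u, dval_fin v); exists (undup (s ++ t)).
by split=> [|i|i]; rewrite ?undup_uniq // mem_undup mem_cat negb_or
  => /andP[? ?]; [apply: us|apply: vt].
Qed.

Lemma dlift_klinear : klinear dlift_fun.
Proof.
split=> [a u|u v].
  have [s [us su _]] := dsum_supp2 u u.
  rewrite !(@dlift_seq _ s) // => [|i /su]; last by rewrite dvalZ => ->; rewrite scaler0.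
  by rewrite scaler_sumr; apply: eq_bigr => i _; rewrite dvalZ linearZ.
have [s [us su sv]] := dsum_supp2 u v.
rewrite !(@dlift_seq _ s) // => [|i si]; last by rewrite dvalD su ?sv // addr0.
by rewrite -big_split; apply: eq_bigr => i _; rewrite dvalD linearD.
Qed.

Definition dlift : {linear dsum -> V} := lin_of dlift_klinear.

Lemma dliftE i (m : M i) : dlift (dinj i m) = f i m.
Proof.
rewrite lin_ofE (@dlift_seq _ [:: i]) // => [|j].
  by rewrite big_seq1 dinj_eq.
by rewrite inE eq_sym => /dinj_neq->.
Qed.

End Lift.

Lemma dsum_decomp (u : dsum) : exists s : seq I, u = \sum_(i <- s) dinj i (u i).
Proof.
have [s [us su _]] := dsum_supp2 u u; exists s; apply: dsumP => j.
rewrite dval_sum; have [js|/[dup] js /su->] := boolP (j \in s).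
  rewrite (bigD1_seq j js us) dinj_eq big1 => [|i /dinj_neq //].
  exact/esym/addr0.
rewrite big_seq big1 // => i si; apply: dinj_neq.
by apply: contraNneq js => <-.
Qed.

Lemma dext (V : lSemiModType k) (f g : {linear dsum -> V}) :
  (forall i m, f (dinj i m) = g (dinj i m)) -> f =1 g.
Proof.
move=> fg u; have [s ->] := dsum_decomp u.
by rewrite !linear_sum; apply: eq_bigr => i _.
Qed.

End DirectSum.

Arguments dinj {k I M} i.

Section Free.
Context {k : comPzSemiRingType} {X : choiceType}.

Definition freemod : lSemiModType k := dsum (fun _ : X => k^o : lSemiModType k).

Definition fgen (x : X) : freemod := dinj x (1 : k^o).

Section Lift.
Context {V : lSemiModType k} (f : X -> V).

Lemma scale_klinear (v : V) : klinear (fun a : k^o => a *: v).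
Proof. by split=> [a b|a b]; rewrite -?scalerDl // scalerA. Qed.

Definition flift : {linear freemod -> V} :=
  dlift (fun x => lin_of (scale_klinear (f x))).

Lemma fliftE x : flift (fgen x) = f x.
Proof. by rewrite dliftE /= scale1r. Qed.

End Lift.

Lemma fext (V : lSemiModType k) (f g : {linear freemod -> V}) :
  (forall x, f (fgen x) = g (fgen x)) -> f =1 g.
Proof.
move=> fg; apply: dext => x a; have -> : a = a *: (1 : k^o).
  by rewrite /GRing.scale /= mulr1.
by rewrite !linearZ; congr (_ *: _); apply: fg.
Qed.

End Free.

Arguments freemod k X : clear implicits.

Section Tensor.
Context {k : comPzSemiRingType}.

Inductive bilin_rel (A B : lSemiModType k) :
    freemod k (A * B)%type -> freemod k (A * B)%type -> Prop :=
| bilin_Dl a a' b :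
    bilin_rel (fgen (a + a', b)) (fgen (a, b) + fgen (a', b))
| bilin_Zl c a b : bilin_rel (fgen (c *: a, b)) (c *: fgen (a, b))
| bilin_Dr a b b' :
    bilin_rel (fgen (a, b + b')) (fgen (a, b) + fgen (a, b'))
| bilin_Zr c a b : bilin_rel (fgen (a, c *: b)) (c *: fgen (a, b)).

Definition tensor (A B : lSemiModType k) : lSemiModType k :=
  mquot (@bilin_rel A B).

Local Notation "A ⊗ B" := (tensor A B) (at level 40, left associativity).

Definition tens {A B : lSemiModType k} (a : A) (b : B) : A ⊗ B :=
  qproj _ (fgen (a, b)).

Lemma tens_linl {A B : lSemiModType k} (b : B) :
  klinear (fun a : A => tens a b).
Proof.
split=> [c a|a a']; rewrite /tens -(linearZ, linearD); apply: qproj_gen.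
  exact: bilin_Zl.
exact: bilin_Dl.
Qed.

Lemma tens_linr {A B : lSemiModType k} (a : A) : klinear (tens a : B -> _).
Proof.
split=> [c b|b b']; rewrite /tens -(linearZ, linearD); apply: qproj_gen.
  exact: bilin_Zr.
exact: bilin_Dr.
Qed.

Section Lift.
Context {A B V : lSemiModType k} (f : A -> B -> V).
Hypothesis (fl : forall b, klinear (f^~ b)) (fr : forall a, klinear (f a)).

Let f' : {linear freemod k (A * B)%type -> V} := flift (fun p => f p.1 p.2).

Lemma tlift_rel u v : bilin_rel u v -> f' u = f' v.
Proof.
by case=> [a a' b|c a b|a b b'|c a b]; rewrite ?(linearZ, linearD) !fliftE /=;
  case: (fl b); case: (fr a).
Qed.

Definition tlift : {linear A ⊗ B -> V} := qlift tlift_rel.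

Lemma tliftE a b : tlift (tens a b) = f a b.
Proof. by rewrite qliftE fliftE. Qed.

End Lift.

Lemma tens_ext (A B V : lSemiModType k) (f g : {linear A ⊗ B -> V}) :
  (forall a b, f (tens a b) = g (tens a b)) -> f =1 g.
Proof.
move=> fg; apply: qext => u.
by apply: (@fext _ _ _ (f \o qproj _) (g \o qproj _)) => -[a b]; apply: fg.
Qed.

Lemma tmap_linl (A A' B B' : lSemiModType k)
    (f : {linear A -> A'}) (g : {linear B -> B'}) b :
  klinear (fun a => tens (f a) (g b)).
Proof. exact: (klinear_comp (g := tens^~ (g b)) (tens_linl _) (linear_klinear f)). Qed.

Lemma tmap_linr (A A' B B' : lSemiModType k)
    (f : {linear A -> A'}) (g : {linear B -> B'}) a :
  klinear (fun b => tens (f a) (g b)).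
Proof. exact: (klinear_comp (g := tens (f a)) (tens_linr _) (linear_klinear g)). Qed.

Definition tmap {A A' B B' : lSemiModType k}
    (f : {linear A -> A'}) (g : {linear B -> B'}) : {linear A ⊗ B -> A' ⊗ B'} :=
  tlift (tmap_linl f g) (tmap_linr f g).

Lemma tmapE (A A' B B' : lSemiModType k)
    (f : {linear A -> A'}) (g : {linear B -> B'}) a b :
  tmap f g (tens a b) = tens (f a) (g b).
Proof. exact: tliftE. Qed.

Section Assoc.
Context (A B C : lSemiModType k).

Definition tassoc1 (c : C) : {linear A ⊗ B -> A ⊗ (B ⊗ C)} :=
  tlift (f := fun a b => tens a (tens b c))
    (fun b => tens_linl _)
    (fun a => klinear_comp (tens_linr _) (tens_linl _)).

Lemma tassoc1E c a b : tassoc1 c (tens a b) = tens a (tens b c).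
Proof. exact: tliftE. Qed.

Lemma tassoc1_lin t : klinear (fun c => tassoc1 c t).
Proof.
split=> [x c|c c'].
  apply: (tens_ext (g := lin_of (klinearZ x (linear_klinear (tassoc1 c))))) => a b.
  by rewrite [RHS]lin_ofE !tassoc1E !(tens_linr _).1.
apply: (tens_ext (g := lin_of (klinearD (linear_klinear (tassoc1 c))
                                    (linear_klinear (tassoc1 c'))))) => a b.
by rewrite [RHS]lin_ofE !tassoc1E !(tens_linr _).2.
Qed.

Definition tassoc : {linear (A ⊗ B) ⊗ C -> A ⊗ (B ⊗ C)} :=
  tlift (f := fun t c => tassoc1 c t)
    (fun c => linear_klinear (tassoc1 c)) tassoc1_lin.

Lemma tassocE a b c : tassoc (tens (tens a b) c) = tens a (tens b c).
Proof. by rewrite !tliftE. Qed.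

End Assoc.
End Tensor.

Notation "A ⊗ B" := (tensor A B) (at level 40, left associativity).


Definition upd {n : nat} {T : Type} (x : 'I_n -> T) (i : 'I_n) (a : T) :
  'I_n -> T := fun j => if j == i then a else x j.

Section SymPower.
Context {k : comPzSemiRingType}.

Definition multilinear {A V : lSemiModType k} n (f : ('I_n -> A) -> V) : Prop :=
  forall x i, klinear (fun a => f (upd x i a)).

Definition symmetric_fun {A V : lSemiModType k} n (f : ('I_n -> A) -> V) : Prop :=
  forall x (s : 'S_n), f (fun i => x (s i)) = f x.

Variable (A : lSemiModType k) (n : nat).

Inductive multilin_rel :
    freemod k ('I_n -> A) -> freemod k ('I_n -> A) -> Prop :=
| multilin_D x i a b :
    multilin_rel (fgen (upd x i (a + b))) (fgen (upd x i a) + fgen (upd x i b))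
| multilin_Z x i c a :
    multilin_rel (fgen (upd x i (c *: a))) (c *: fgen (upd x i a)).

Definition tpower : lSemiModType k := mquot multilin_rel.

Definition ptens (x : 'I_n -> A) : tpower := qproj _ (fgen x).

(* Coinvariants of the symmetric group acting on the tensor power; pure tensors
   span, so it is enough to identify their translates *)
Inductive perm_rel : tpower -> tpower -> Prop :=
| perm_rel_intro x (s : 'S_n) : perm_rel (ptens (fun i => x (s i))) (ptens x).

Definition spower : lSemiModType k := mquot perm_rel.

Definition stens (x : 'I_n -> A) : spower := qproj _ (ptens x).

Lemma stens_multilinear : multilinear stens.
Proof.
move=> x i; apply: klinear_comp; first exact: linear_klinear.
split=> [c a|a b]; rewrite /ptens -(linearZ, linearD); apply: qproj_gen.
  exact: multilin_Z.
exact: multilin_D.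
Qed.

Lemma stens_symmetric : symmetric_fun stens.
Proof. by move=> x s; apply: qproj_gen; apply: perm_rel_intro. Qed.

Section Lift.
Context {V : lSemiModType k} (f : ('I_n -> A) -> V).
Hypothesis (fm : multilinear f) (fs : symmetric_fun f).

Lemma plift_rel u v : multilin_rel u v -> flift f u = flift f v.
Proof.
by case=> [x i a b|x i c a]; rewrite ?(linearZ, linearD) !fliftE;
  case: (fm x i).
Qed.

Definition plift : {linear tpower -> V} := qlift plift_rel.

Lemma pliftE x : plift (ptens x) = f x.
Proof. by rewrite qliftE fliftE. Qed.

Lemma slift_rel u v : perm_rel u v -> plift u = plift v.
Proof. by case=> x s; rewrite !pliftE. Qed.

Definition slift : {linear spower -> V} := qlift slift_rel.

Lemma sliftE x : slift (stens x) = f x.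
Proof. by rewrite qliftE pliftE. Qed.

End Lift.

Lemma sext (V : lSemiModType k) (f g : {linear spower -> V}) :
  (forall x, f (stens x) = g (stens x)) -> f =1 g.
Proof.
move=> fg; apply: qext => u.
apply: (@qext _ _ _ _ (f \o qproj _) (g \o qproj _)) => {}u.
by apply: (@fext _ _ _ (f \o qproj _ \o qproj _) (g \o qproj _ \o qproj _)) => x;
  apply: fg.
Qed.

End SymPower.

Section QObj.
Context {k : comPzSemiRingType}.

Definition SymAlg (A : lSemiModType k) : lSemiModType k :=
  dsum (fun n : nat => spower A n).

Definition Q (A : lSemiModType k) : lSemiModType k :=
  dsum (fun x0 : A => SymAlg A).

(* ⟨x0, x 0, ..., x (n - 1)⟩; the summand is indexed by x0, so this is not linear
   in x0 *)
Definition Qgen {A : lSemiModType k} (x0 : A) n (x : 'I_n -> A) : Q A :=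
  dinj (M := fun _ : A => SymAlg A) x0
    (dinj (M := fun n => spower A n) n (stens x)).

Lemma Qgen_multilinear (A : lSemiModType k) (x0 : A) n :
  multilinear (@Qgen A x0 n).
Proof.
move=> x i; apply: klinear_comp; first exact: linear_klinear.
apply: klinear_comp; first exact: linear_klinear.
exact: stens_multilinear.
Qed.

Lemma Qgen_symmetric (A : lSemiModType k) (x0 : A) n :
  symmetric_fun (@Qgen A x0 n).
Proof. by move=> x s; rewrite /Qgen stens_symmetric. Qed.

Section Lift.
Context {A V : lSemiModType k} (f : A -> forall n, ('I_n -> A) -> V).
Hypothesis (fm : forall x0 n, multilinear (@f x0 n)).
Hypothesis (fs : forall x0 n, symmetric_fun (@f x0 n)).

Definition Qlift : {linear Q A -> V} :=
  dlift (fun x0 => dlift (fun n => slift (@fm x0 n) (@fs x0 n))).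

Lemma QliftE x0 n (x : 'I_n -> A) : Qlift (Qgen x0 x) = f x0 x.
Proof. by rewrite /Qlift /Qgen !dliftE sliftE. Qed.

End Lift.

Lemma Qext (A V : lSemiModType k) (f g : {linear Q A -> V}) :
  (forall x0 n (x : 'I_n -> A), f (Qgen x0 x) = g (Qgen x0 x)) -> f =1 g.
Proof.
move=> fg; apply: dext => x0.
apply: (@dext _ _ _ _ (f \o dinj x0) (g \o dinj x0)) => n.
apply: (@sext _ _ _ _ (f \o dinj x0 \o dinj n) (g \o dinj x0 \o dinj n)) => x.
exact: fg.
Qed.

End QObj.

Section Brackets.
Context {k : comPzSemiRingType}.

(* [Qgen] on lists: ⟨x0, x1, ..., xn⟩ for s = [:: x1; ...; xn] *)
Definition br {A : lSemiModType k} (x0 : A) (s : seq A) : Q A :=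
  Qgen x0 (fun i : 'I_(size s) => nth 0 s i).

Context {A : lSemiModType k}.

Lemma br_size (x0 : A) n s : size s = n -> br x0 s = Qgen x0 (fun i : 'I_n => nth 0 s i).
Proof. by move=> <-. Qed.

Lemma br_codom (x0 : A) n (x : 'I_n -> A) : br x0 [seq x i | i : 'I_n] = Qgen x0 x.
Proof.
rewrite (@br_size _ n) ?size_image ?card_ord //; congr Qgen; apply: funext => i.
rewrite (nth_map i) ?size_enum_ord ?nth_ord_enum //.
Qed.

Lemma br_perm (x0 : A) s t : perm_eq s t -> br x0 s = br x0 t.
Proof.
move=> st; rewrite (br_size x0 (perm_size st)).
have /tuple_permP [p ->] : perm_eq s (in_tuple t) by [].
rewrite -[RHS](Qgen_symmetric _ _ p); congr Qgen; apply: funext => i.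
rewrite (nth_map i) ?size_enum_ord // nth_ord_enum (tnth_nth 0) //.
Qed.

Lemma br_mid_klinear (x0 : A) s1 s2 : klinear (fun a => br x0 (s1 ++ a :: s2)).
Proof.
have lt : (size s1 < size s1 + (size s2).+1)%N by rewrite addnS ltnS leq_addr.
apply: klinear_ext (Qgen_multilinear x0 (fun j => nth 0 (s1 ++ 0 :: s2) j)
  (Ordinal lt)) => a /=.
rewrite (@br_size _ (size s1 + (size s2).+1)) ?size_cat //; congr Qgen.
apply: funext => j; rewrite /upd -val_eqE /= !nth_cat.
case: ltngtP => //= [lt'|->]; last by rewrite subnn.
by rewrite -(subnSK lt').
Qed.

Lemma br_map_klinear (U : lSemiModType k) (J : eqType) (x0 : A) s1 s2 (e : seq J)
    (j0 : J) (F : U -> J -> A) :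
  uniq e -> j0 \in e ->
  (forall j, j \in e -> j != j0 -> forall a b, F a j = F b j) ->
  klinear (F^~ j0) ->
  klinear (fun a => br x0 (s1 ++ [seq F a j | j <- e] ++ s2)).
Proof.
move=> ue je Fc Fl; move: ue Fc; case/splitPr: je => p1 p2.
rewrite cat_uniq /= negb_or => /and3P[_ /andP[j1 _] /andP[j2 _]] Fc.
apply: klinear_ext (klinear_comp
  (br_mid_klinear x0 (s1 ++ [seq F 0 j | j <- p1]) ([seq F 0 j | j <- p2] ++ s2))
  Fl) => a.
rewrite map_cat /= -!catA /=; congr (br _ (_ ++ _ ++ _ :: _ ++ _));
  apply/eq_in_map => j jp; apply: Fc; rewrite ?mem_cat ?inE ?jp ?orbT //;
  by apply: contraTneq jp => ->.
Qed.

End Brackets.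

Lemma perm_enum_imset (T T' : finType) (f : T -> T') (B : {set T}) :
  injective f -> perm_eq (enum (f @: B)%SET) [seq f x | x <- enum B].
Proof.
move=> fi; apply: uniq_perm; rewrite ?map_inj_uniq ?enum_uniq // => y.
rewrite mem_enum; apply/imsetP/mapP => -[x xB ->]; exists x => //;
  by rewrite mem_enum in xB *.
Qed.

Section QComonad.
Context {k : comPzSemiRingType}.

Definition Qmap_fun {A B : lSemiModType k} (f : {linear A -> B})
    (x0 : A) n (x : 'I_n -> A) : Q B := Qgen (f x0) (fun i => f (x i)).

Lemma Qmap_multilinear (A B : lSemiModType k) (f : {linear A -> B}) x0 n :
  multilinear (@Qmap_fun A B f x0 n).
Proof.
move=> x i; apply: klinear_ext (klinear_comp
  (Qgen_multilinear (f x0) (fun j => f (x j)) i) (linear_klinear f)) => a.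
by congr Qgen; apply: funext => j; rewrite /upd; case: ifP.
Qed.

Lemma Qmap_symmetric (A B : lSemiModType k) (f : {linear A -> B}) x0 n :
  symmetric_fun (@Qmap_fun A B f x0 n).
Proof. by move=> x s; rewrite /Qmap_fun -[RHS](Qgen_symmetric _ _ s). Qed.

Definition Qmap {A B : lSemiModType k} (f : {linear A -> B}) :
    {linear Q A -> Q B} :=
  Qlift (Qmap_multilinear f) (Qmap_symmetric f).

Definition counit_fun {A : lSemiModType k} (x0 : A) n : ('I_n -> A) -> A :=
  match n with
  | 0 => fun=> x0
  | 1 => fun x => x ord0
  | _ => fun=> 0
  end.

Lemma counit_multilinear (A : lSemiModType k) (x0 : A) n :
  multilinear (@counit_fun A x0 n).
Proof.
case: n => [|[|n]] x i /=; first by case: i.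
  by apply: klinear_ext (klinear_id _) => a; rewrite /upd (ord1 i).
exact: klinear0.
Qed.

Lemma counit_symmetric (A : lSemiModType k) (x0 : A) n :
  symmetric_fun (@counit_fun A x0 n).
Proof. by case: n => [|[|n]] x s //=; rewrite (ord1 (s _)). Qed.

Definition counit (A : lSemiModType k) : {linear Q A -> A} :=
  Qlift (@counit_multilinear A) (@counit_symmetric A).

(* A set partition P of 'I_n has distinct blocks B, listed here in the order of
   an enumeration; [br_perm] makes that order irrelevant *)
Definition comult_fun {A : lSemiModType k} (x0 : A) n (x : 'I_n -> A) : Q (Q A) :=
  \sum_(P : {set {set 'I_n}} | partition P [set: 'I_n]%SET)
     br (br x0 [::]) [seq br x0 [seq x i | i in B] | B : {set 'I_n} in P].

Lemma comult_multilinear (A : lSemiModType k) (x0 : A) n :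
  multilinear (@comult_fun A x0 n).
Proof.
move=> x i; apply: klinear_sum => P /and3P[/eqP covP /trivIsetP trP _].
have /bigcupP[B0 B0P iB0] : i \in cover P by rewrite covP inE.
pose F a (B : {set 'I_n}) := br x0 [seq upd x i a j | j in B].
have Fl : klinear (F^~ B0).
  have := @br_map_klinear k A A _ x0 [::] [::] (enum B0) i (fun a => upd x i a).
  rewrite enum_uniq mem_enum iB0 => /(_ isT isT) Hl.
  apply: klinear_ext (Hl _ _) => [a|j _ /negPf ne a b|].
  - by rewrite cat0s cats0.
  - by rewrite /upd ne.
  - by apply: klinear_ext (klinear_id _) => a; rewrite /upd eqxx.
have := @br_map_klinear k (Q A) A _ (br x0 [::]) [::] [::] (enum P) B0 F.
rewrite enum_uniq mem_enum B0P => /(_ isT isT) Hl.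
apply: klinear_ext (Hl _ Fl) => [a|B]; first by rewrite cat0s cats0.
rewrite mem_enum => BP neB a b; congr br; apply/eq_in_map => j.
rewrite mem_enum => jB; rewrite /upd; case: eqP => // ji.
have /disjointFr/(_ jB) := trP _ _ BP B0P neB.
by rewrite ji iB0.
Qed.

Lemma comult_symmetric (A : lSemiModType k) (x0 : A) n :
  symmetric_fun (@comult_fun A x0 n).
Proof.
move=> x s; rewrite /comult_fun.
pose h (t : 'S_n) (P : {set {set 'I_n}}) := ((fun B : {set 'I_n} => t @: B) @: P)%SET.
have hK t : cancel (h t) (h t^-1%g).
  move=> P; rewrite /h -imset_comp -[RHS]imset_id; apply: eq_imset => B /=.
  rewrite -imset_comp -[RHS]imset_id; apply: eq_imset => j /=.
  exact: permK.
have bij_h : bijective (h s).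
  by exists (h s^-1%g) => // P; rewrite -{1}[s]invgK hK.
rewrite [RHS](reindex (h s)) /=; last exact: onW_bij.
have si := @perm_inj _ s.
apply: eq_big => [P|P _].
  rewrite -(imset_partition _ _ si) -/(h s P); congr partition.
  apply/setP => i; rewrite !inE; apply/imsetP.
  by exists (s^-1%g i); rewrite ?inE ?permKV.
apply: br_perm; rewrite perm_sym.
have img_inj : injective (fun B : {set 'I_n} => s @: B)%SET.
  exact: imset_inj.
apply: perm_trans (perm_map _ (perm_enum_imset P img_inj)) _.
rewrite -map_comp (@eq_map _ _ _
  (fun B : {set 'I_n} => br x0 [seq x (s i) | i in B])) // => B /=.
apply: br_perm.
apply: perm_trans (perm_map _ (perm_enum_imset B si)) _.
by rewrite -map_comp.
Qed.

Definition comult (A : lSemiModType k) : {linear Q A -> Q (Q A)} :=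
  Qlift (@comult_multilinear A) (@comult_symmetric A).

End QComonad.

Section QMonoidal.
Context {k : comPzSemiRingType}.

(* A partial isomorphism from 'I_n to 'I_p, i.e. a bijection from a subset I of
   'I_n to a subset J of 'I_p, is a partial function that is injective on its
   domain of definition I; J is then its image *)
Definition partial_iso n p (t : {ffun 'I_n -> option 'I_p}) : bool :=
  [forall i, forall i', (t i == t i') && (t i != None) ==> (i == i')].

Lemma partial_isoP n p (t : {ffun 'I_n -> option 'I_p}) :
  reflect (forall i i' j, t i = Some j -> t i' = Some j -> i = i')
    (partial_iso t).
Proof.
apply: (iffP forallP) => [H i i' j ti ti'|H i].
  by have /forallP/(_ i') := H i; rewrite ti ti' eqxx => /eqP.
apply/forallP => i'; apply/implyP => /andP[/eqP e]; case ti: (t i) => [j|] // _.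
by apply/eqP/(H _ _ j); rewrite -?e.
Qed.

Section Components.
Context {A B : lSemiModType k}.

(* All the entries but the first one of the summand of m_⊗ indexed by t; the
   second list ranges over the j outside the image of t *)
Definition mtens_entries n p (x0 : A) (x : 'I_n -> A) (y0 : B) (y : 'I_p -> B)
    (t : {ffun 'I_n -> option 'I_p}) : seq (A ⊗ B) :=
  [seq tens (x i) (if t i is Some j then y j else y0) | i : 'I_n] ++
  [seq tens x0 (y j) | j : 'I_p in [pred j | Some j \notin codom t]].

Definition mtens_fun n p (x0 : A) (x : 'I_n -> A) (y0 : B) (y : 'I_p -> B) :
    Q (A ⊗ B) :=
  \sum_(t : {ffun 'I_n -> option 'I_p} | partial_iso t)
    br (tens x0 y0) (mtens_entries x0 x y0 y t).

Lemma mtens_multilinear_l n p x0 y0 (y : 'I_p -> B) :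
  multilinear (fun x : 'I_n -> A => mtens_fun x0 x y0 y).
Proof.
move=> x i; apply: klinear_sum => t _.
pose F a j := tens (upd x i a j) (if t j is Some l then y l else y0).
have := @br_map_klinear k (A ⊗ B) A _ (tens x0 y0) [::]
  [seq tens x0 (y j) | j : 'I_p in [pred j | Some j \notin codom t]]
  (enum 'I_n) i F.
rewrite enum_uniq mem_enum => /(_ isT isT) Hl.
apply: Hl => [j _ /negPf ne a b|]; first by rewrite /F /upd ne.
by apply: klinear_ext (tens_linl _) => a; rewrite /F /upd eqxx.
Qed.

Lemma mtens_multilinear_r n p x0 (x : 'I_n -> A) y0 :
  multilinear (fun y : 'I_p -> B => mtens_fun x0 x y0 y).
Proof.
move=> y j0; apply: klinear_sum => t /partial_isoP tP.
have [/codomP[i0 ti0]|nj0] := boolP (Some j0 \in codom t).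
  pose F b i := tens (x i) (if t i is Some j then upd y j0 b j else y0).
  have := @br_map_klinear k (A ⊗ B) B _ (tens x0 y0) [::]
    [seq tens x0 (y j) | j : 'I_p in [pred j | Some j \notin codom t]]
    (enum 'I_n) i0 F.
  rewrite enum_uniq mem_enum => /(_ isT isT) Hl.
  apply: klinear_ext (Hl _ _) => [b|i _ ne a b|] /=.
  - rewrite /mtens_entries; congr (br _ (_ ++ _)).
    apply/eq_in_map => j; rewrite mem_enum inE => nj; rewrite /upd.
    by case: eqP => // jj0; rewrite jj0 ti0 codom_f in nj.
  - rewrite /F /upd; case ti: (t i) => [j|] //; case: eqP => // jj0.
    by case/eqP: ne; apply: (tP _ _ j0); rewrite // ti jj0.
  - by apply: klinear_ext (tens_linr (x i0)) => b; rewrite /F -ti0 /upd eqxx.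
pose F b j := tens x0 (upd y j0 b j).
have := @br_map_klinear k (A ⊗ B) B _ (tens x0 y0)
  [seq tens (x i) (if t i is Some j then y j else y0) | i : 'I_n] [::]
  (enum [pred j | Some j \notin codom t]) j0 F.
rewrite enum_uniq mem_enum inE nj0 => /(_ isT isT) Hl.
apply: klinear_ext (Hl _ _) => [b|j _ /negPf ne a b|].
- rewrite /mtens_entries cats0; congr (br _ (_ ++ _)).
  apply: eq_map => i; case ti: (t i) => [j|] //; rewrite /upd.
  by case: eqP => // jj0; rewrite -jj0 -ti codom_f in nj0.
- by rewrite /F /upd ne.
- by apply: klinear_ext (tens_linr x0) => b; rewrite /F /upd eqxx.
Qed.

Lemma mtens_symmetric_l n p x0 y0 (y : 'I_p -> B) :
  symmetric_fun (fun x : 'I_n -> A => mtens_fun x0 x y0 y).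
Proof.
move=> x s; rewrite /mtens_fun.
pose h (s : 'S_n) (t : {ffun 'I_n -> option 'I_p}) := [ffun i => t (s i)].
have bij_h : bijective (h s).
  by exists (h s^-1%g) => t; apply/ffunP => i; rewrite !ffunE ?permK ?permKV.
rewrite [LHS](reindex (h s)) /=; last exact: onW_bij.
apply: eq_big => [t|t _].
  apply/partial_isoP/partial_isoP => H i i' j.
    move=> ti ti'; rewrite -[i](permKV s) -[i'](permKV s); congr (s _).
    by apply: (H _ _ j); rewrite ffunE permKV.
  by rewrite !ffunE => ti ti'; apply/(@perm_inj _ s)/(H _ _ j).
apply: br_perm; apply: perm_cat.
  have := perm_map (fun i => tens (x i) (if t i is Some j then y j else y0))
    (perm_enum_imset [set: 'I_n]%SET (@perm_inj _ s)).
  rewrite -map_comp => H; rewrite perm_sym.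
  have e0 : perm_eq (enum 'I_n) (enum (s @: [set: 'I_n])%SET).
    apply: uniq_perm; rewrite ?enum_uniq // => i; rewrite !mem_enum.
    by apply/esym/imsetP; exists (s^-1%g i); rewrite ?inE ?permKV.
  apply: perm_trans (perm_map _ e0) (perm_trans H _).
  have -> : enum [set: 'I_n]%SET = enum 'I_n.
    by apply: eq_enum => i; rewrite inE.
  rewrite (@eq_map _ _ _ (fun i => tens (x (s i))
    (if h s t i is Some j then y j else y0))) // => i /=; by rewrite ffunE.
rewrite /image_mem (@eq_enum _ _ [pred j | Some j \notin codom t]) // => j.
rewrite !inE; congr (~~ _); apply/codomP/codomP => -[i].
  by rewrite ffunE => ->; exists (s i).
by move=> ->; exists (s^-1%g i); rewrite ffunE permKV.
Qed.

Lemma mtens_symmetric_r n p x0 (x : 'I_n -> A) y0 :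
  symmetric_fun (fun y : 'I_p -> B => mtens_fun x0 x y0 y).
Proof.
move=> y s; rewrite /mtens_fun.
pose h (s : 'S_p) (t : {ffun 'I_n -> option 'I_p}) := [ffun i => omap s (t i)].
have bij_h : bijective (h s).
  exists (h s^-1%g) => t; apply/ffunP => i; rewrite !ffunE;
    by case: (t i) => //= j; rewrite ?permK ?permKV.
rewrite [RHS](reindex (h s)) /=; last exact: onW_bij.
have hS t i j : (h s t i = Some (s j)) <-> (t i = Some j).
  rewrite ffunE; case: (t i) => //= l; split=> [[/perm_inj->]|[->]] //.
apply: eq_big => [t|t _].
  apply/partial_isoP/partial_isoP => H i i' j.
    by rewrite -[j](permKV s) => /hS ti /hS; apply: H.
  by move=> /hS ti /hS; apply: H.
apply: br_perm; rewrite /mtens_entries; apply: perm_cat.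
  rewrite /image_mem (@eq_map _ _ _ (fun i => tens (x i)
    (if h s t i is Some j then y j else y0))) // => i.
  by rewrite ffunE; case: (t i).
pose N (t : {ffun 'I_n -> option 'I_p}) := [set j | Some j \notin codom t]%SET.
have eN (t' : {ffun 'I_n -> option 'I_p}) :
    enum [pred j | Some j \notin codom t'] = enum (N t').
  by apply: eq_enum => j; rewrite !inE.
rewrite /image_mem !eN perm_sym.
have e0 : perm_eq (enum (N (h s t))) (enum (s @: N t)%SET).
  apply: uniq_perm; rewrite ?enum_uniq // => j; rewrite !mem_enum.
  rewrite -[j](permKV s) mem_imset; last exact: perm_inj.
  rewrite !inE; congr (~~ _); apply/codomP/codomP => -[i /esym];
    by move=> /hS ?; exists i.
apply: perm_trans (perm_map _ e0) _.
apply: perm_trans (perm_map _ (perm_enum_imset (N t) (@perm_inj _ s))) _.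
by rewrite -map_comp.
Qed.

Definition mtens1 (x0 : A) n (x : 'I_n -> A) : {linear Q B -> Q (A ⊗ B)} :=
  Qlift (f := fun y0 p y => mtens_fun x0 x y0 y)
    (fun y0 p => mtens_multilinear_r x0 x y0)
    (fun y0 p => mtens_symmetric_r x0 x y0).

Lemma mtens1_multilinear (v : Q B) (x0 : A) n :
  multilinear (fun x : 'I_n -> A => mtens1 x0 x v).
Proof.
move=> x i; split=> [c a|a b].
  apply: (Qext (g := lin_of (klinearZ c (linear_klinear (mtens1 x0 (upd x i a))))))
    => y0 p y.
  by rewrite [RHS]lin_ofE !QliftE (mtens_multilinear_l _ _ _ _ _).1.
apply: (Qext (g := lin_of (klinearD (linear_klinear (mtens1 x0 (upd x i a)))
                                    (linear_klinear (mtens1 x0 (upd x i b))))))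
    => y0 p y.
by rewrite [RHS]lin_ofE !QliftE (mtens_multilinear_l _ _ _ _ _).2.
Qed.

Lemma mtens1_symmetric (v : Q B) (x0 : A) n :
  symmetric_fun (fun x : 'I_n -> A => mtens1 x0 x v).
Proof.
move=> x s; apply: Qext => y0 p y; rewrite !QliftE.
exact: mtens_symmetric_l.
Qed.

Definition mtens2 (v : Q B) : {linear Q A -> Q (A ⊗ B)} :=
  Qlift (f := fun x0 n x => mtens1 x0 x v)
    (mtens1_multilinear v) (mtens1_symmetric v).

Lemma mtens2_klinear (u : Q A) : klinear (fun v => mtens2 v u).
Proof.
split=> [c v|v w].
  apply: (Qext (g := lin_of (klinearZ c (linear_klinear (mtens2 v))))) => x0 n x.
  by rewrite [RHS]lin_ofE !QliftE linearZ.
apply: (Qext (g := lin_of (klinearD (linear_klinear (mtens2 v))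
                                    (linear_klinear (mtens2 w))))) => x0 n x.
by rewrite [RHS]lin_ofE !QliftE linearD.
Qed.

End Components.

Definition mtens (A B : lSemiModType k) : {linear Q A ⊗ Q B -> Q (A ⊗ B)} :=
  tlift (f := fun u v => mtens2 v u)
    (fun v => linear_klinear (mtens2 v)) mtens2_klinear.

Lemma mtensE (A B : lSemiModType k) n p (x0 : A) (x : 'I_n -> A) (y0 : B)
    (y : 'I_p -> B) :
  mtens A B (tens (Qgen x0 x) (Qgen y0 y)) = mtens_fun x0 x y0 y.
Proof. by rewrite tliftE !QliftE. Qed.

Definition fusion (X Y : lSemiModType k) : {linear Q X ⊗ Q Y -> Q (X ⊗ Q Y)} :=
  mtens X (Q Y) \o tmap idfun (comult Y).

End QMonoidal.

(* Both notions of category below are structures on a given [kgraph] (objects,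
   hom-modules, identities) and a given choice of [products]: this is the data
   that passing from one notion to the other leaves unchanged. In [products] the
   projections are mere elements of hom-modules, and nothing is assumed of them
   before a notion of composition is present. *)
Record kgraph (k : comPzSemiRingType) := KGraph {
  ob :> Type;
  hom : ob -> ob -> lSemiModType k;
  idm : forall A, hom A A }.

Arguments hom {k G} A B : rename.
Arguments idm {k G} A : rename.

Record products (k : comPzSemiRingType) (G : kgraph k) := Products {
  one_ob : G;
  prd : G -> G -> G;
  pi0 : forall A B, hom (prd A B) A;
  pi1 : forall A B, hom (prd A B) B }.

Arguments one_ob {k G} P : rename.
Arguments prd {k G} P A B : rename.
Arguments pi0 {k G} P {A B} : rename.
Arguments pi1 {k G} P {A B} : rename.

Record llcat (k : comPzSemiRingType) (G : kgraph k) := LLCat {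
  mcomp : forall A B C : G, hom B C -> hom A B -> hom A C;
  comp_assoc : forall (A B C D : G) (h : hom C D) (g : hom B C) (f : hom A B),
    mcomp h (mcomp g f) = mcomp (mcomp h g) f;
  comp_idl : forall (A B : G) (f : hom A B), mcomp (idm B) f = f;
  comp_idr : forall (A B : G) (f : hom A B), mcomp f (idm A) = f;
  comp_linl : forall (A B C : G) (f : hom A B),
    klinear (fun g : hom B C => mcomp g f) }.

Arguments mcomp {k G} L {A B C} g f : rename.

Record cllcat (k : comPzSemiRingType) (G : kgraph k) (P : products G) := CLLCat {
  cll_llcat :> llcat G;
  cll_one : forall X : G, exists! f : hom X (one_ob P), True;
  mpair : forall X A B : G, hom X A -> hom X B -> hom X (prd P A B);
  pair_pi0 : forall (X A B : G) (f : hom X A) (g : hom X B),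
    mcomp cll_llcat (pi0 P) (mpair f g) = f;
  pair_pi1 : forall (X A B : G) (f : hom X A) (g : hom X B),
    mcomp cll_llcat (pi1 P) (mpair f g) = g;
  pair_uniq : forall (X A B : G) (f : hom X A) (g : hom X B)
      (h : hom X (prd P A B)),
    mcomp cll_llcat (pi0 P) h = f -> mcomp cll_llcat (pi1 P) h = g -> h = mpair f g;
  pair_lin : forall X A B : G,
    klinear (fun h : hom X (prd P A B) =>
      (mcomp cll_llcat (pi0 P) h, mcomp cll_llcat (pi1 P) h)) }.

Arguments mpair {k G P} L {X A B} f g : rename.

Section DiffAxioms.
Context {k : comPzSemiRingType} {G : kgraph k} {P : products G} (L : cllcat P).

Local Notation "g ∘ f" := (mcomp L g f) (at level 40, left associativity).
Local Notation "⟪ f , g ⟫" := (mpair L f g).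
Local Notation "A × B" := (prd P A B) (at level 40, left associativity).

Record diff_axioms (D : forall A B : G, hom A B -> hom (A × A) B) : Prop := {
  diff_lin : forall A B : G, klinear (@D A B);
  diff_linr : forall (A B Z : G) (f : hom A B) (x v w : hom Z A) (l m : k),
    D _ _ f ∘ ⟪x, l *: v + m *: w⟫ =
    l *: (D _ _ f ∘ ⟪x, v⟫) + m *: (D _ _ f ∘ ⟪x, w⟫);
  diff_pi0 : forall A0 A1 : G,
    D _ _ (pi0 P : hom (A0 × A1) A0) = pi0 P ∘ pi1 P;
  diff_pi1 : forall A0 A1 : G,
    D _ _ (pi1 P : hom (A0 × A1) A1) = pi1 P ∘ pi1 P;
  diff_id : forall A : G, D _ _ (idm A) = pi1 P;
  diff_comp : forall (A B C : G) (g : hom B C) (f : hom A B),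
    D _ _ (g ∘ f) = D _ _ g ∘ ⟪f ∘ pi0 P, D _ _ f⟫;
  diff_diff_lin : forall (A B Z : G) (f : hom A B) (x r v : hom Z A),
    D _ _ (D _ _ f) ∘ ⟪⟪x, r⟫, ⟪0, v⟫⟫ = D _ _ f ∘ ⟪x, v⟫;
  diff_diff_sym : forall (A B Z : G) (f : hom A B) (x r s : hom Z A),
    D _ _ (D _ _ f) ∘ ⟪⟪x, r⟫, ⟪s, 0⟫⟫ = D _ _ (D _ _ f) ∘ ⟪⟪x, s⟫, ⟪r, 0⟫⟫ }.

End DiffAxioms.

Record cdc (k : comPzSemiRingType) (G : kgraph k) (P : products G) := CDC {
  cdc_cllcat :> cllcat P;
  diff : forall A B : G, hom A B -> hom (prd P A A) B;
  diffP : diff_axioms cdc_cllcat diff }.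

Arguments diff {k G P} C {A B} f : rename.

Section Derivatives.
Context {k : comPzSemiRingType} {G : kgraph k} {P : products G} (C : cdc P).

(* A × A^n, bracketed to the left *)
Fixpoint tpow (A : G) (n : nat) : G :=
  if n is n'.+1 then prd P (tpow A n') A else A.

(* (x 0, x 1, ..., x n) *)
Fixpoint tup {X A : G} (n : nat) (x : nat -> hom X A) : hom X (tpow A n) :=
  if n is n'.+1 then mpair C (tup n' x) (x n) else x 0%N.

(* f^(n+1) is D(f^(n)) evaluated at ((x_0, ..., x_n), (x_{n+1}, 0, ..., 0)), with
   n zeros, where (x_0, ..., x_n) is the first projection of A × A^(n+1) and
   x_{n+1} the second one; see [derS] *)
Fixpoint der {A B : G} (f : hom A B) (n : nat) : hom (tpow A n) B :=
  if n is n'.+1 then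
    mcomp C (diff C (der f n'))
      (mpair C (pi0 P) (tup n' (fun i => if i is 0 then pi1 P else 0)))
  else f.

Lemma comp0 (X Y Z : G) (f : hom X Y) : mcomp C (0 : hom Y Z) f = 0.
Proof.
by rewrite -[0 in LHS](scale0r 0) (comp_linl C Z f).1 scale0r.
Qed.

Lemma comp_pair (W X A B : G) (f : hom X A) (g : hom X B) (h : hom W X) :
  mcomp C (mpair C f g) h = mpair C (mcomp C f h) (mcomp C g h).
Proof. by apply: pair_uniq; rewrite comp_assoc ?pair_pi0 ?pair_pi1. Qed.

Lemma comp_tup (W X A : G) n (x : nat -> hom X A) (h : hom W X) :
  mcomp C (tup n x) h = tup n (fun i => mcomp C (x i) h).
Proof. by elim: n => //= n IH; rewrite comp_pair IH. Qed.

Lemma eq_tup (X A : G) n (x y : nat -> hom X A) : x =1 y -> tup n x = tup n y.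
Proof. by move=> xy; elim: n => [|n IH] /=; rewrite ?IH xy. Qed.

Lemma der0 (X A B : G) (f : hom A B) (x : nat -> hom X A) :
  mcomp C (der f 0) (tup 0 x) = mcomp C f (x 0%N).
Proof. by []. Qed.

Lemma derS (X A B : G) (f : hom A B) n (x : nat -> hom X A) :
  mcomp C (der f n.+1) (tup n.+1 x) =
  mcomp C (diff C (der f n))
    (mpair C (tup n x) (tup n (fun i => if i is 0 then x n.+1 else 0))).
Proof.
rewrite /= -comp_assoc comp_pair pair_pi0 comp_tup; congr (mcomp C _ (mpair C _ _)).
by apply: eq_tup => -[|i]; rewrite ?pair_pi1 ?comp0.
Qed.

Definition Dlinear {A B : G} (f : hom A B) : Prop :=
  forall (Z : G) (x v : hom Z A), mcomp C (diff C f) (mpair C x v) = mcomp C f v.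

End Derivatives.

Record qcat (k : comPzSemiRingType) (G : kgraph k) := QCat {
  qm : forall A B C : G, {linear hom B C ⊗ Q (hom A B) -> hom A C};
  qm_assoc : forall (A B C D : G)
      (z : hom C D ⊗ Q (hom B C) ⊗ Q (hom A B)),
    qm A B D (tmap (qm B C D) idfun z) =
    qm A C D (tmap idfun (Qmap (qm A B C)) (tmap idfun (fusion _ _)
      (tassoc _ _ _ z)));
  qm_idl : forall (A B : G) (t : Q (hom A B)),
    qm A B B (tens (idm B) t) = counit _ t;
  qm_idr : forall (A B : G) (g : hom A B),
    qm A A B (tens g (br (idm A) [::])) = g }.

Arguments qm {k G} M {A B C} : rename.

Section QLinear.
Context {k : comPzSemiRingType} {G : kgraph k} (M : qcat G).

Record qlinmap (A B : G) := QLinMap {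
  qlin :> forall X : G, {linear hom X A -> hom X B};
  qlin_m : forall (X Y : G) (z : hom Y A ⊗ Q (hom X Y)),
    qlin X (qm M z) = qm M (tmap (qlin Y) idfun z) }.

Definition underlying {A B : G} (g : qlinmap A B) : hom A B := g A (idm A).

Definition Qlinear {A B : G} (f : hom A B) : Prop :=
  exists g : qlinmap A B, underlying g = f.

End QLinear.

Definition product_diagram (k : comPzSemiRingType) (U V W : lSemiModType k)
    (p : {linear W -> U}) (q : {linear W -> V}) : Prop :=
  forall (Z : lSemiModType k) (a : {linear Z -> U}) (b : {linear Z -> V}),
  exists h : {linear Z -> W},
    (forall z, p (h z) = a z /\ q (h z) = b z) /\
    forall h' : {linear Z -> W},
      (forall z, p (h' z) = a z /\ q (h' z) = b z) -> h' =1 h.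

(* The projections are k-Mod^Q-linear maps; [pi0] and [pi1] are the underlying
   maps, which determine them *)
Record cqcat (k : comPzSemiRingType) (G : kgraph k) (P : products G) := CQCat {
  cq_qcat :> qcat G;
  cq_one : forall (X : G) (f : hom X (one_ob P)), f = 0;
  cq_prod : forall A B : G,
    exists (p0 : qlinmap cq_qcat (prd P A B) A) (p1 : qlinmap cq_qcat (prd P A B) B),
      [/\ underlying p0 = pi0 P, underlying p1 = pi1 P
        & forall X : G, product_diagram (p0 X) (p1 X)] }.

(* Main.v *)
Require Import Defs.
From mathcomp Require Import boolp.
From mathcomp Require Import all_boot ssralg perm.

(** Write g • t for the action of a map g on a formal element t of Q. Both
    structures say what g • ⟨f0, ..., fn⟩ is: in a cartesian differential category
    it is the n-th derivative of g at f0 along f1, ..., fn. The translations are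
    inverse to each other because both kinds of action obey the same first-order
    rule, expressed by an operator on Q.

    For linear maps p and d from U to V, the operator [qder p d] from Q U to Q V
    sends ⟨x0, ..., xn⟩ to ⟨p x0, ..., p xn, d x0⟩ plus the sum over i of
    ⟨p x0, ..., d xi, ..., p xn⟩. It is the derivative of Q at p along d. It is
    compatible with the comultiplication ([qdup_qder]) and with m_⊗
    ([qtens_qder]), hence with the fusion map ([qsubst_qder]). The explicit sums
    over set partitions and partial isomorphisms enter only through the effect of
    adjoining one entry ([comult_funS], [mtens_withinS]).

    In a cartesian differential category the chain rule for higher derivatives
    becomes: the derivative of g • t at a along b is g • [qder p d] t, where p is
    precomposition with a and d is the derivative at a along b ([dird_cdcm]).
    Every bracket is reached in this way from brackets without entries, at the
    price of a variable: ⟨f0, ..., fn, v⟩ is the [qder] of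
    ⟨f0 π0 + π1, f1 π0, ..., fn π0⟩ that differentiates in the second variable at
    0 along v ([qder_shift_var_id]). Associativity of the action then goes by
    induction on the number of entries of the innermost argument ([cdcm_assoc]).

    Conversely, associativity of a composition law m on Q gives
    (g • t) • ⟨X, Y⟩ = g • [qder p d] t, where p and d send f to f • ⟨X⟩ and to
    f • ⟨X, Y⟩ ([qm_subst], [qsubst_br1]). With t = ⟨π0, π1⟩ this computes the
    second derivative ([qdiff_diff]), from which the axioms on D can be read off.
    It is also the same rule as above, so the same induction on entries shows
    that the higher derivatives so obtained give back m ([q_cdcmE]). *)

Set Implicit Arguments.
Unset Strict Implicit.
Unset Printing Implicit Defensive.

Import GRing.Theory.
Local Open Scope ring_scope.

(** * Linear maps out of Q *)

(** Invariance under permutations of a function defined by recursion on a list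
    need only be checked in these four cases. *)
Lemma perm_eq_ind (T : eqType) (R : seq T -> seq T -> Prop) :
  R [::] [::] ->
  (forall x s t, R s t -> R (x :: s) (x :: t)) ->
  (forall x y s, R (x :: y :: s) (y :: x :: s)) ->
  (forall s t u, R s t -> R t u -> R s u) ->
  forall s t, perm_eq s t -> R s t.
Proof.
move=> R0 Rc Rs Rt.
have Rr s : R s s by elim: s => // x s; apply: Rc.
have Rm x s1 s2 : R (x :: s1 ++ s2) (s1 ++ x :: s2).
  elim: s1 => [|y s1 IH]; first exact: Rr.
  by apply: Rt (Rs _ _ _) _; apply: Rc.
elim=> [|x s IH] t st; first by move: st; rewrite perm_sym => /perm_nilP->.
have xt : x \in t by rewrite -(perm_mem st) mem_head.
case/splitPr: xt st => t1 t2.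
rewrite -[x :: t2]cat1s perm_sym (perm_catCA t1 [:: x] t2) /=.
rewrite perm_cons perm_sym => st.
by apply: Rt (Rm _ _ _); apply: Rc; apply: IH.
Qed.

Ltac klin := by split=> [? ?|? ?]; rewrite ?linearZ ?linearD.

Section QAlgebra.
Context {k : comPzSemiRingType}.
Implicit Types A B U V : lSemiModType k.

Lemma klinear_eq0 (U V : lSemiModType k) (f : U -> V) : klinear f -> f 0 = 0.
Proof. by case=> fZ _; rewrite -[0 in LHS](scale0r 0) fZ scale0r. Qed.

Lemma lin_klinear A U V (f : {linear U -> V}) (g : A -> U) :
  klinear g -> klinear (fun x => f (g x)).
Proof. by move=> gl; apply: klinear_comp; first exact: linear_klinear. Qed.

Lemma slin_subproof :
  {F : forall (U V : lSemiModType k) (f : U -> V), klinear f -> {linear U -> V} |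
   forall U V (f : U -> V) (fl : klinear f) u, F U V f fl u = f u}.
Proof. by exists (@lin_of k). Qed.

(** Opaque, as are the operators on Q below: each of them is known through its
    values on generators, never through its construction from quotients. *)
Definition slin U V (f : U -> V) (fl : klinear f) : {linear U -> V} :=
  sval slin_subproof U V f fl.

Lemma slinE U V (f : U -> V) (fl : klinear f) u : slin fl u = f u.
Proof. exact: (svalP slin_subproof). Qed.

Section ListLift.
Context {A V : lSemiModType k} (F : A -> seq A -> V).
Hypothesis (Fl : forall x0 s, klinear (fun x => F x0 (x :: s))).
Hypothesis (Fp : forall x0 s t, perm_eq s t -> F x0 s = F x0 t).

Let f x0 n (x : 'I_n -> A) := F x0 [seq x i | i : 'I_n].

(** A permutation brings any entry to the head of the list, so linearity in the
    head is enough. *)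
Lemma list_multilinear x0 n : multilinear (@f x0 n).
Proof.
move=> x i; rewrite /f.
apply: klinear_ext (Fl x0 [seq x j | j in predC1 i]) => a; apply: Fp.
rewrite perm_sym.
have H : perm_eq [seq upd x i a j | j : 'I_n]
   [seq upd x i a j | j <- i :: enum (predC1 i)].
  apply: perm_map; apply: uniq_perm; rewrite ?enum_uniq //=.
    by rewrite enum_uniq mem_enum !inE eqxx.
  by move=> j; rewrite !(inE, mem_enum) orbN.
apply: perm_trans H _; rewrite /= {1}/upd eqxx perm_cons.
rewrite (@eq_in_map _ _ _ x _).1 // => j.
by rewrite mem_enum inE /upd => /negPf->.
Qed.

Lemma list_symmetric x0 n : symmetric_fun (@f x0 n).
Proof.
move=> x s; apply: Fp.
rewrite [X in perm_eq X _](map_comp x s); apply: perm_map; apply: uniq_perm.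
- by rewrite map_inj_uniq ?enum_uniq //; apply: perm_inj.
- exact: enum_uniq.
by move=> j; rewrite mem_enum -[j](permKV s) mem_map ?mem_enum //; apply: perm_inj.
Qed.

Definition Llift : {linear Q A -> V} := Qlift list_multilinear list_symmetric.

Lemma LliftE x0 s : Llift (br x0 s) = F x0 s.
Proof.
rewrite QliftE /f; congr F.
rewrite -[RHS](mkseq_nth 0) /mkseq -val_enum_ord -map_comp.
exact: eq_map.
Qed.

End ListLift.

Lemma tens_klinear_ext A B V (f g : A ⊗ B -> V) :
  klinear f -> klinear g ->
  (forall a b, f (tens a b) = g (tens a b)) -> f =1 g.
Proof. by move=> fl gl; apply: (tens_ext (f := lin_of fl) (g := lin_of gl)). Qed.

Lemma tensmap_subproof :
  {F : forall A A' B B' : lSemiModType k, {linear A -> A'} -> {linear B -> B'} ->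
         {linear A ⊗ B -> A' ⊗ B'} |
   forall A A' B B' (f : {linear A -> A'}) (g : {linear B -> B'}) a b,
     F A A' B B' f g (tens a b) = tens (f a) (g b)}.
Proof. by exists (@tmap k) => *; apply: tmapE. Qed.

Definition tensmap A A' B B' := sval tensmap_subproof A A' B B'.

Lemma tensmapE A A' B B' (f : {linear A -> A'}) (g : {linear B -> B'}) a b :
  tensmap f g (tens a b) = tens (f a) (g b).
Proof. exact: (svalP tensmap_subproof). Qed.

Lemma br_klinear_ext A V (f g : Q A -> V) :
  klinear f -> klinear g ->
  (forall x0 s, f (br x0 s) = g (br x0 s)) -> f =1 g.
Proof.
move=> fl gl fg; apply: (Qext (f := lin_of fl) (g := lin_of gl)) => x0 n x.
by rewrite -br_codom; apply: fg.
Qed.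

Lemma br_cons_klinear A (x0 : A) s : klinear (fun x => br x0 (x :: s)).
Proof. exact: (br_mid_klinear x0 [::] s). Qed.

Lemma qcons_subproof1 A (x : A) x0 s : klinear (fun y : A => br x0 (x :: y :: s)).
Proof. exact: (br_mid_klinear x0 [:: x] s). Qed.

Lemma qcons_subproof2 A (x : A) x0 s t :
  perm_eq s t -> br x0 (x :: s) = br x0 (x :: t).
Proof. by move=> st; apply: br_perm; rewrite perm_cons. Qed.

Lemma qcons_subproof :
  {F : forall A, A -> {linear Q A -> Q A} |
   forall A (x x0 : A) s, F A x (br x0 s) = br x0 (x :: s)}.
Proof.
exists (fun A (x : A) => Llift (qcons_subproof1 x) (@qcons_subproof2 A x)) => *.
exact: LliftE.
Qed.

Definition qcons A := sval qcons_subproof A.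

Lemma qconsE A (x x0 : A) s : qcons x (br x0 s) = br x0 (x :: s).
Proof. exact: (svalP qcons_subproof). Qed.

Lemma qcons_klinear A (u : Q A) : klinear (fun x => qcons x u).
Proof.
split=> [c x|x y]; move: u; apply: br_klinear_ext => [||x0 s]; try klin.
- exact/klinearZ/linear_klinear.
- by rewrite !qconsE (br_cons_klinear x0 s).1.
- by apply: klinearD; apply: linear_klinear.
- by rewrite !qconsE (br_cons_klinear x0 s).2.
Qed.

Lemma qins_subproof :
  {F : forall A, {linear A ⊗ Q A -> Q A} |
   forall A (x : A) u, F A (tens x u) = qcons x u}.
Proof.
exists (fun A => tlift (f := fun x u => qcons x u) (@qcons_klinear A)
    (fun x => linear_klinear (qcons x))) => *.
exact: tliftE.
Qed.

Definition qins A := sval qins_subproof A.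

Lemma qinsE A (x : A) u : qins A (tens x u) = qcons x u.
Proof. exact: (svalP qins_subproof). Qed.

(** Every generator is obtained from some ⟨x0⟩ by adjoining entries one at a
    time, so an identity of linear maps out of Q A goes by induction on the
    entries. *)
Lemma qcons_klinear_ext A V (f g : Q A -> V) :
  klinear f -> klinear g ->
  (forall x0, f (br x0 [::]) = g (br x0 [::])) ->
  (forall x u, f u = g u -> f (qcons x u) = g (qcons x u)) -> f =1 g.
Proof.
move=> fl gl f0 fS; apply: br_klinear_ext => // x0; elim=> [|x s IH] //.
by rewrite -qconsE; apply: fS.
Qed.

Lemma qconsC A (x y : A) u : qcons x (qcons y u) = qcons y (qcons x u).
Proof.
move: u; apply: br_klinear_ext => [||x0 s]; try klin.
by rewrite !qconsE; apply: br_perm; rewrite (perm_catCA [:: x] [:: y] s).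
Qed.

(** Splits off one entry in all possible ways; the base point counts as an
    entry that is not used up:
    ⟨x0, ..., xn⟩ is sent to x0 ⊗ ⟨x0, ..., xn⟩ plus the sum over i of
    xi ⊗ ⟨x0, ..., xn without xi⟩. *)
Fixpoint pick_fun A (x0 : A) (s : seq A) : A ⊗ Q A :=
  if s is x :: s' then tens x (br x0 s') + tensmap idfun (qcons x) (pick_fun x0 s')
  else tens x0 (br x0 [::]).

Lemma pick_funS A (x0 x : A) s : pick_fun x0 (x :: s) =
  tens x (br x0 s) + tensmap idfun (qcons x) (pick_fun x0 s).
Proof. by []. Qed.

Lemma tensmap_klinearr (P A A' B B' : lSemiModType k) (f : {linear A -> A'})
    (g : P -> {linear B -> B'}) :
  (forall u, klinear (fun p => g p u)) -> forall w, klinear (fun p => tensmap f (g p) w).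
Proof.
move=> gl w; split=> [c x|x y]; move: w; apply: tens_klinear_ext => [||a b]; try klin.
- exact/klinearZ/linear_klinear.
- by rewrite !tensmapE (gl b).1 (tens_linr _).1.
- by apply: klinearD; apply: linear_klinear.
- by rewrite !tensmapE (gl b).2 (tens_linr _).2.
Qed.

Lemma pick_subproof1 A (x0 : A) s : klinear (fun x => pick_fun x0 (x :: s)).
Proof.
apply: klinearD; first exact: tens_linl.
by apply: (@tensmap_klinearr _ _ _ _ _ idfun (@qcons A)) => u; apply: qcons_klinear.
Qed.

Lemma tensmap_comp (A1 A2 A3 B1 B2 B3 : lSemiModType k)
  (f : {linear A1 -> A2}) (f' : {linear A2 -> A3})
  (g : {linear B1 -> B2}) (g' : {linear B2 -> B3}) w :
  tensmap f' g' (tensmap f g w) = tensmap (f' \o f) (g' \o g) w.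
Proof. by move: w; apply: tens_klinear_ext => [||a b]; try klin; rewrite !tensmapE. Qed.

Lemma eq_tensmap (A A' B B' : lSemiModType k) (f f' : {linear A -> A'})
    (g g' : {linear B -> B'}) :
  f =1 f' -> g =1 g' -> tensmap f g =1 tensmap f' g'.
Proof. by move=> ff gg; apply: tens_ext => a b; rewrite !tensmapE ff gg. Qed.

Lemma pick_subproof2 A (x0 : A) s t : perm_eq s t -> pick_fun x0 s = pick_fun x0 t.
Proof.
move=> st; suff [] : perm_eq s t /\ pick_fun x0 s = pick_fun x0 t by [].
elim/perm_eq_ind: st => {s t} // [x s t [st e]|x y s|s t u [st ->] [tu ->]].
- by rewrite perm_cons !pick_funS (br_perm x0 st) e.
- split; first by rewrite (perm_catCA [:: x] [:: y] s).
  rewrite !pick_funS !linearD !addrA !tensmapE !qconsE; congr (_ + _).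
    by rewrite addrC.
  by rewrite !tensmap_comp; apply: eq_tensmap => // v; apply: (qconsC x y v).
- by split=> //; apply: perm_trans st tu.
Qed.

Lemma qpick_subproof :
  {F : forall A, {linear Q A -> A ⊗ Q A} |
   forall A (x0 : A) s, F A (br x0 s) = pick_fun x0 s}.
Proof.
by exists (fun A => Llift (@pick_subproof1 A) (@pick_subproof2 A)) => *; apply: LliftE.
Qed.

Definition qpick A := sval qpick_subproof A.

Lemma qpickE A (x0 : A) s : qpick A (br x0 s) = pick_fun x0 s.
Proof. exact: (svalP qpick_subproof). Qed.

Lemma qpick0 A (x0 : A) : qpick A (br x0 [::]) = tens x0 (br x0 [::]).
Proof. exact: qpickE. Qed.

Lemma qpick_cons A (x : A) u :
  qpick A (qcons x u) = tens x u + tensmap idfun (qcons x) (qpick A u).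
Proof.
move: u; apply: br_klinear_ext => [||x0 s]; first klin.
  by apply: klinearD; [apply: tens_linr|klin].
by rewrite qconsE !qpickE.
Qed.

Lemma counit_br (A : lSemiModType k) (x0 : A) s :
  counit A (br x0 s) = if s is x :: s' then (if s' is [::] then x else 0) else x0.
Proof. by rewrite QliftE; case: s => [|x [|y s]]. Qed.

(** * The derivative operator on Q *)

Lemma qmap_subproof :
  {F : forall A B, {linear A -> B} -> {linear Q A -> Q B} |
   forall A B (f : {linear A -> B}) x0 s, F A B f (br x0 s) = br (f x0) (map f s)}.
Proof.
exists (@Qmap k) => A B f x0 s.
rewrite QliftE /Qmap_fun (@br_size _ _ _ (size s)) ?size_map //; congr Qgen.
by apply: funext => i; rewrite (nth_map 0).
Qed.

Definition qmap A B := sval qmap_subproof A B.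

Lemma qmapE A B (f : {linear A -> B}) x0 s :
  qmap f (br x0 s) = br (f x0) (map f s).
Proof. exact: (svalP qmap_subproof). Qed.

Lemma qmap0 A B (f : {linear A -> B}) x0 : qmap f (br x0 [::]) = br (f x0) [::].
Proof. exact: qmapE. Qed.

Lemma qmap_cons A B (f : {linear A -> B}) x u :
  qmap f (qcons x u) = qcons (f x) (qmap f u).
Proof.
move: u; apply: br_klinear_ext => [||x0 s]; try klin.
by rewrite qconsE !qmapE qconsE.
Qed.

Lemma eq_qmap A B (f g : {linear A -> B}) : f =1 g -> qmap f =1 qmap g.
Proof.
move=> fg; apply: qcons_klinear_ext => [||x0|x u e]; try klin.
  by rewrite !qmap0 fg.
by rewrite !qmap_cons fg e.
Qed.

Lemma qmap_comp A B U (f : {linear A -> B}) (g : {linear B -> U}) u :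
  qmap g (qmap f u) = qmap (g \o f) u.
Proof.
move: u; apply: qcons_klinear_ext => [||x0|x u e]; try klin.
  by rewrite !qmap0.
by rewrite !qmap_cons e.
Qed.

Lemma qmap_id A u : qmap (idfun : {linear A -> A}) u = u.
Proof.
move: u; apply: qcons_klinear_ext => [||x0|x u e]; try klin.
  by rewrite !qmap0.
by rewrite !qmap_cons e.
Qed.

Lemma qpick_nat A B (f : {linear A -> B}) u :
  qpick B (qmap f u) = tensmap f (qmap f) (qpick A u).
Proof.
move: u; apply: qcons_klinear_ext => [||x0|x u e]; try klin.
  by rewrite qmap0 !qpick0 tensmapE qmap0.
rewrite qmap_cons !qpick_cons linearD tensmapE e !tensmap_comp; congr (_ + _).
by apply: eq_tensmap => // v; rewrite /= -qmap_cons.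
Qed.

Lemma qins_nat A B (f : {linear A -> B}) w :
  qmap f (qins A w) = qins B (tensmap f (qmap f) w).
Proof.
move: w; apply: tens_klinear_ext => [||a b]; try klin.
by rewrite tensmapE !qinsE qmap_cons.
Qed.

Lemma qder_subproof :
  {F : forall U V, {linear U -> V} -> {linear U -> V} -> {linear Q U -> Q V} |
   forall U V (p d : {linear U -> V}) u,
     F U V p d u = qins V (tensmap d (qmap p) (qpick U u))}.
Proof.
by exists (fun U V (p d : {linear U -> V}) => qins V \o tensmap d (qmap p) \o qpick U).
Qed.

(** The derivative of Q at p along d:
    ⟨x0, ..., xn⟩ is sent to ⟨p x0, ..., p xn, d x0⟩ plus the sum over i of
    ⟨p x0, ..., d xi, ..., p xn⟩. Formally this is the coefficient of ε in
    Q (p + ε d) when ε ^ 2 = 0 and a displacement ε v of the base point means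
    adjoining the entry v. *)
Definition qder U V := sval qder_subproof U V.

Lemma qderE U V (p d : {linear U -> V}) u :
  qder p d u = qins V (tensmap d (qmap p) (qpick U u)).
Proof. exact: (svalP qder_subproof). Qed.

Lemma qder0 U V (p d : {linear U -> V}) x0 :
  qder p d (br x0 [::]) = br (p x0) [:: d x0].
Proof. by rewrite qderE qpick0 tensmapE qmap0 qinsE qconsE. Qed.

Lemma qins_cons V (v : V) w : qins V (tensmap idfun (qcons v) w) = qcons v (qins V w).
Proof.
move: w; apply: tens_klinear_ext => [||a b]; try klin.
by rewrite tensmapE !qinsE qconsC.
Qed.

(** Together with [qder0], this determines [qder]. *)
Lemma qder_cons U V (p d : {linear U -> V}) x u :
  qder p d (qcons x u) = qcons (p x) (qder p d u) + qcons (d x) (qmap p u).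
Proof.
rewrite !qderE qpick_cons !linearD tensmapE qinsE addrC; congr (_ + _).
rewrite tensmap_comp -qins_cons tensmap_comp; congr (qins _ _); apply: eq_tensmap => // v.
exact: qmap_cons.
Qed.

Lemma qmap_qder A U V (f : {linear U -> V}) (p d : {linear A -> U}) u :
  qmap f (qder p d u) = qder (f \o p) (f \o d) u.
Proof.
by rewrite !qderE qins_nat tensmap_comp; congr (qins _ _); apply: eq_tensmap => // v;
  rewrite -qmap_comp.
Qed.

Lemma qder_qmap A U V (f : {linear A -> U}) (p d : {linear U -> V}) u :
  qder p d (qmap f u) = qder (p \o f) (d \o f) u.
Proof.
rewrite !qderE qpick_nat tensmap_comp; congr (qins _ _); apply: eq_tensmap => // v.
by rewrite -qmap_comp.
Qed.

Lemma eq_qder U V (p p' d d' : {linear U -> V}) :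
  p =1 p' -> d =1 d' -> qder p d =1 qder p' d'.
Proof.
move=> ep ed u; rewrite !qderE; congr (qins _ _); apply: eq_tensmap => //.
exact: eq_qmap.
Qed.

Lemma qder_br_congr (U V U' : lSemiModType k) (p d : {linear U -> V})
    (p' d' : {linear U' -> V}) (j : U' -> U) x0 x0' s :
  p x0 = p' x0' -> d x0 = d' x0' ->
  (forall x, p (j x) = p' x) -> (forall x, d (j x) = d' x) ->
  qder p d (br x0 [seq j x | x <- s]) = qder p' d' (br x0' s).
Proof.
move=> p0 d0 pj dj; elim: s => [|x s IH]; first by rewrite !qder0 p0 d0.
rewrite map_cons -!qconsE !qder_cons IH pj dj; congr (_ + qcons _ _).
rewrite !qmapE p0 -map_comp; congr br; exact: eq_map.
Qed.

(** If d vanishes on the entries, then only the displacement of the base point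
    contributes. *)
Lemma qder_const (U V : lSemiModType k) (p d : {linear U -> V}) x0 s :
  (forall x, x \in s -> d x = 0) ->
  qder p d (br x0 s) = br (p x0) (d x0 :: map p s).
Proof.
elim: s => [|x s IH] s0; first by rewrite qder0.
rewrite -qconsE qder_cons IH => [|y ys]; last by apply: s0; rewrite inE ys orbT.
rewrite (s0 x) ?mem_head // (klinear_eq0 (qcons_klinear _)) addr0 qconsE.
by apply: br_perm; rewrite /= (perm_catCA [:: _] [:: _]).
Qed.

Lemma qder_ins U V (p d : {linear U -> V}) w :
  qder p d (qins U w) =
  qins V (tensmap p (qder p d) w) + qins V (tensmap d (qmap p) w).
Proof.
move: w; apply: tens_klinear_ext => [||x u]; first klin.
  by apply: klinearD; klin.
by rewrite !tensmapE !qinsE qder_cons.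
Qed.

Lemma tensmapDr (A1 A2 B1 B2 : lSemiModType k) (f : {linear A1 -> A2})
    (g g1 g2 : {linear B1 -> B2}) w :
  (forall v, g v = g1 v + g2 v) ->
  tensmap f g w = tensmap f g1 w + tensmap f g2 w.
Proof.
move=> gE; move: w; apply: tens_klinear_ext => [||a b]; first klin.
  by apply: klinearD; klin.
by rewrite !tensmapE gE (tens_linr _).2.
Qed.

(** Leibniz rule: d hits either what is left behind or the entry split off. *)
Lemma qpick_qder U V (p d : {linear U -> V}) u :
  qpick V (qder p d u) =
  tensmap p (qder p d) (qpick U u) + tensmap d (qmap p) (qpick U u).
Proof.
move: u; apply: qcons_klinear_ext => [||x0|x u e].
- klin.
- by apply: klinearD; klin.
- by rewrite qder0 -qconsE qpick_cons !qpick0 !tensmapE qder0 qmap0 qconsE addrC.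
rewrite qder_cons linearD !qpick_cons e !linearD !tensmapE !tensmap_comp.
rewrite qpick_nat tensmap_comp -!addrA.
rewrite (@tensmapDr _ _ _ _ _ (qder p d \o qcons x)
  (qcons (p x) \o qder p d) (qcons (d x) \o qmap p)); last exact: qder_cons.
rewrite -!addrA addrCA addrA [RHS]addrCA addrA -!addrA.
have E1 (g : {linear Q U -> Q V}) w :
    tensmap (p \o idfun) g w = tensmap (idfun \o p) g w by apply: eq_tensmap.
have -> : tensmap (d \o idfun) (qmap p \o qcons x) (qpick U u) =
    tensmap (idfun \o d) (qcons (p x) \o qmap p) (qpick U u).
  by apply: eq_tensmap => // v; apply: (qmap_cons p x v).
rewrite !E1; congr (_ + (_ + _)).
by rewrite addrC addrAC addrC.
Qed.

(** Symmetry of second derivatives: both orders produce the same mixed terms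
    once e makes up for the failure of d to intertwine c and c'. *)
Lemma qderC U V (p d e : {linear U -> V}) (c : {linear U -> U}) (c' : {linear V -> V}) u :
  (forall x, p (c x) = c' (p x)) -> (forall x, d (c x) = c' (d x) + e x) ->
  qder p d (qder idfun c u) = qder idfun c' (qder p d u) + qder p e u.
Proof.
move=> pc dc; move: u; apply: qcons_klinear_ext => [||x0|x u IH].
- klin.
- by apply: klinearD; klin.
- rewrite !qder0 -!qconsE !qder_cons !qder0 !qmap0 !qconsE pc dc.
  rewrite (br_cons_klinear _ _).2 addrA.
  by rewrite (br_perm _ (_ : perm_eq [:: c' (p x0); d x0] [:: d x0; c' (p x0)])) //
    (perm_catCA [:: c' _] [:: d _] [::]).
have Qc v : qder p d (qmap idfun v) = qder p d v.
  by apply: congr1; apply: qmap_id.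
have Qm v : qmap p (qder idfun c v) = qder idfun c' (qmap p v).
  by rewrite qmap_qder qder_qmap; apply: eq_qder => // y; apply: pc.
rewrite !qder_cons !linearD !qder_cons IH Qm pc dc /= qmap_id.
rewrite (qcons_klinear _).2 !qmap_id !linearD !addrA.
by rewrite [LHS](ACl (1*4*3*5*2*6)).
Qed.
End QAlgebra.

(** * Set partitions and the comultiplication *)

Section QComb.
Context {k : comPzSemiRingType}.
Implicit Types A B U V : lSemiModType k.

Lemma qpick_seq A (T : eqType) (f : T -> A) y0 (e : seq T) :
  qpick A (br y0 [seq f i | i <- e]) = tens y0 (br y0 [seq f i | i <- e]) +
    \sum_(i <- e) tens (f i) (br y0 [seq f j | j <- rem i e]).
Proof.
elim: e => [|x e IH]; first by rewrite qpick0 big_nil addr0.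
rewrite map_cons -qconsE qpick_cons IH big_cons linearD tensmapE /= eqxx.
rewrite addrCA; congr (_ + (_ + _)).
rewrite linear_sum; apply: eq_big_seq => i ie.
rewrite tensmapE qconsE; congr tens; have [->|_] := eqVneq x i; last by [].
apply: br_perm; rewrite -map_cons; apply: perm_map; rewrite perm_sym.
exact: perm_to_rem.
Qed.

Lemma perm_enumD1 (T : finType) (S : {set T}) i :
  perm_eq (rem i (enum S)) (enum (S :\ i)).
Proof.
apply: uniq_perm; rewrite ?rem_uniq ?enum_uniq // => j.
by rewrite mem_rem_uniq ?enum_uniq // !inE !mem_enum !inE.
Qed.

Lemma perm_enumU1 (T : finType) (S : {set T}) i : i \notin S ->
  perm_eq (enum (i |: S)) (i :: enum S).
Proof.
move=> iS; apply: uniq_perm => [||j]; rewrite ?enum_uniq //.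
  by rewrite /= enum_uniq mem_enum iS.
by rewrite !(inE, mem_enum).
Qed.

Lemma qpick_set A (T : finType) (f : T -> A) y0 (S : {set T}) :
  qpick A (br y0 [seq f i | i in S]) = tens y0 (br y0 [seq f i | i in S]) +
    \sum_(i in S) tens (f i) (br y0 [seq f j | j in S :\ i]).
Proof.
rewrite /image_mem qpick_seq big_enum; congr (_ + _); apply: eq_bigr => i _.
by rewrite (br_perm _ (perm_map f (perm_enumD1 S i))).
Qed.

End QComb.

Lemma partition_setTP (T : finType) (P : {set {set T}}) :
  reflect [/\ set0 \notin P, forall x, exists2 B, B \in P & x \in B &
    forall B B' x, B \in P -> B' \in P -> x \in B -> x \in B' -> B = B']
  (partition P [set: T]).
Proof.
apply: (iffP and3P) => [[/eqP covP trP P0]|[P0 Pc Pu]].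
  split=> // [x|B B' x BP B'P xB xB'].
    by have : x \in cover P; [rewrite covP|case/bigcupP => B; exists B].
  by rewrite -(def_pblock trP BP xB) (def_pblock trP B'P xB').
split=> //; first by apply/eqP/setP => x; rewrite inE; apply/bigcupP.
apply/trivIsetP => B B' BP B'P; apply: contraNT => /pred0Pn[x /andP[xB xB']].
by apply/eqP; apply: (Pu _ _ x).
Qed.

Section SetPartitions.
Context (n : nat).
Local Notation T := 'I_n.
Local Notation S := 'I_n.+1.
Implicit Types (P : {set {set T}}) (o B : {set T}).

Definition blift B : {set S} := lift ord0 @: B.
Definition bunlift (B : {set S}) : {set T} := lift ord0 @^-1: B.

(** A partition of n + 1 points is a partition P of the last n of them together
    with what remains of the block of the first point. The remainder o is a
    block of P, or empty if the first point is alone; removing the empty set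
    from P changes nothing, so both cases have the same formula. *)
Definition ext_part (Po : {set {set T}} * {set T}) : {set {set S}} :=
  (ord0 |: blift Po.2) |: [set blift B | B in Po.1 :\ Po.2].

Definition res_part (P' : {set {set S}}) : {set {set T}} * {set T} :=
  ([set bunlift B | B in P'] :\ set0, bunlift (pblock P' ord0)).

Lemma mem_blift B i : (lift ord0 i \in blift B) = (i \in B).
Proof. by rewrite mem_imset //; apply: lift_inj. Qed.

Lemma ord0_blift B : (ord0 \in blift B) = false.
Proof. by apply/imsetP => -[i _ e]. Qed.

Lemma bliftK : cancel blift bunlift.
Proof. by move=> B; apply/setP => i; rewrite inE mem_blift. Qed.

Lemma bunlift_ext B : bunlift (ord0 |: blift B) = B.
Proof. by apply/setP => i; rewrite !inE mem_blift. Qed.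

Lemma ext_bunlift (B : {set S}) : ord0 \in B -> ord0 |: blift (bunlift B) = B.
Proof.
move=> B0; apply/setP => i; rewrite !inE; case: (unliftP ord0 i) => [j ->|->].
  by rewrite mem_blift inE.
by rewrite eqxx B0.
Qed.

Lemma bunliftK (B : {set S}) : ord0 \notin B -> blift (bunlift B) = B.
Proof.
move=> /negPf B0; apply/setP => i; case: (unliftP ord0 i) => [j ->|->].
  by rewrite mem_blift inE.
by rewrite ord0_blift B0.
Qed.

Lemma ext_part_spec P o (B' : {set S}) : reflect
  (B' = ord0 |: blift o \/ exists2 B, B \in P /\ B != o & B' = blift B)
  (B' \in ext_part (P, o)).
Proof.
rewrite !inE; apply: (iffP orP) => -[].
- by move/eqP->; left.
- by case/imsetP => B; rewrite !inE => /andP[? ?] ->; right; exists B.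
- by move->; left.
- by case=> B [BP Bo] ->; right; apply/imsetP; exists B; rewrite ?inE ?Bo.
Qed.

Lemma mem_part0 P o i : o \in set0 |: P -> i \in o -> o \in P.
Proof. by rewrite !inE => /orP[/eqP->|//]; rewrite inE. Qed.

Lemma ext_partP P o : partition P [set: T] -> o \in set0 |: P ->
  partition (ext_part (P, o)) [set: S].
Proof.
move=> /partition_setTP[P0 Pc Pu] oP; apply/partition_setTP; split.
- apply/negP => /ext_part_spec[/setP/(_ ord0)|[B [BP _] /(congr1 bunlift)]].
    by rewrite !inE eqxx.
  rewrite bliftK => e; case/negP: P0; suff -> : set0 = B by [].
  by rewrite -e; apply/setP => i; rewrite !inE.
- move=> x; case: (unliftP ord0 x) => [i ->|->]; last first.
    by exists (ord0 |: blift o); [apply/ext_part_spec; left|rewrite !inE eqxx].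
  have [B BP iB] := Pc i; have [Bo|Bo] := eqVneq B o.
    exists (ord0 |: blift o); first by apply/ext_part_spec; left.
    by rewrite !inE mem_blift -Bo iB orbT.
  by exists (blift B); [apply/ext_part_spec; right; exists B|rewrite mem_blift].
have aux B x : B \in P -> B != o -> x \in ord0 |: blift o -> x \in blift B -> False.
  move=> BP Bo; case: (unliftP ord0 x) => [i ->|->]; last by rewrite ord0_blift.
  rewrite !inE !mem_blift /= => io iB; case/eqP: Bo; apply: (Pu _ _ i) => //.
  exact: mem_part0 io.
move=> B B' x /ext_part_spec[->|[C [CP Co] ->]] /ext_part_spec[->|[C' [C'P C'o] ->]] //.
- by move=> xo /(aux _ _ C'P C'o xo).
- by move=> xC /aux/(_ xC)=> /(_ CP Co).
case: (unliftP ord0 x) => [i ->|->]; last by rewrite ord0_blift.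
by rewrite !mem_blift => iC iC'; rewrite (Pu _ _ i CP C'P iC iC').
Qed.

Lemma res_partP (P' : {set {set S}}) : partition P' [set: S] ->
  partition (res_part P').1 [set: T] /\ (res_part P').2 \in set0 |: (res_part P').1.
Proof.
move=> partP; have /partition_setTP[P0 Pc Pu] := partP; split.
  apply/partition_setTP; split=> [|i|B B' i] /=.
  - by rewrite !inE eqxx.
  - have [B BP iB] := Pc (lift ord0 i); exists (bunlift B); last by rewrite inE.
    rewrite !inE imset_f // andbT; apply/set0Pn; exists i; by rewrite inE.
  rewrite !inE => /andP[_ /imsetP[C CP ->]] /andP[_ /imsetP[C' CP' ->]].
  by rewrite !inE => iC iC'; rewrite (Pu _ _ _ CP CP' iC iC').
rewrite /= !inE; case: eqP => //= _; apply: imset_f.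
by apply: pblock_mem; case/and3P: partP => /eqP->; rewrite inE.
Qed.

Lemma ext_partK P o : partition P [set: T] -> o \in set0 |: P ->
  res_part (ext_part (P, o)) = (P, o).
Proof.
move=> partP oP; have partE := ext_partP partP oP.
have /and3P[_ trE _] := partE; have /and3P[_ _ P0] := partP.
rewrite /res_part; congr pair; last first.
  rewrite (@def_pblock _ _ (ord0 |: blift o)) ?bunlift_ext //.
    by apply/ext_part_spec; left.
  by rewrite !inE eqxx.
apply/setP => B; rewrite !inE; apply/andP/idP => [[B0 /imsetP[C]]|BP].
  case/ext_part_spec=> [->|[D [DP _] ->]]; last by rewrite bliftK => ->.
  rewrite bunlift_ext => Bo; move: oP; rewrite -Bo !inE.
  by rewrite (negPf B0).
split; first by apply: contraNneq P0 => <-.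
apply/imsetP; have [Bo|Bo] := eqVneq B o.
  by exists (ord0 |: blift o); [apply/ext_part_spec; left|rewrite bunlift_ext].
by exists (blift B); [apply/ext_part_spec; right; exists B|rewrite bliftK].
Qed.

Lemma res_partK (P' : {set {set S}}) : partition P' [set: S] -> ext_part (res_part P') = P'.
Proof.
move=> partP; have /partition_setTP[P0 Pc Pu] := partP.
have c0 : ord0 \in cover P' by case/and3P: partP => /eqP->; rewrite inE.
have pb0 : ord0 \in pblock P' ord0 by rewrite mem_pblock.
have pbP : pblock P' ord0 \in P' by apply: pblock_mem.
have liftE (B : {set S}) : B \in P' -> B != pblock P' ord0 -> blift (bunlift B) = B.
  move=> BP Bb; apply: bunliftK; apply: contraNN Bb => B0.
  by apply/eqP; apply: (Pu _ _ ord0).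
apply/setP => B; apply/ext_part_spec/idP => [[->|[C [CP Co] ->]]|BP].
- by rewrite ext_bunlift.
- move: CP; rewrite !inE => /andP[C0 /imsetP[D DP CD]].
  rewrite CD liftE //; apply: contraNneq Co => e; by rewrite CD e.
have [->|Bb] := eqVneq B (pblock P' ord0); first by left; rewrite ext_bunlift.
right; exists (bunlift B); last by rewrite liftE.
have nB : exists i, lift ord0 i \in B.
  have /set0Pn[x xB] : B != set0 by apply: contraNneq P0 => <-.
  move: xB; rewrite -(liftE _ BP Bb); case/imsetP => i iB _; exists i.
  by rewrite mem_blift.
have [i iB] := nB; split.
  rewrite !inE imset_f // andbT; apply/set0Pn; exists i; by rewrite inE.
apply: contraNneq Bb => /setP/(_ i); rewrite !inE iB => /esym ib.
by apply/eqP; apply: (Pu _ _ (lift ord0 i)).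
Qed.

End SetPartitions.

Section Comult.
Context {k : comPzSemiRingType}.
Implicit Types A U V : lSemiModType k.

Lemma br_imset A (T T' : finType) (h : T -> T') (f : T' -> A) x0 (B : {set T}) :
  injective h ->
  br x0 [seq f i | i in h @: B] = br x0 [seq f (h i) | i in B].
Proof.
move=> hi.
rewrite /image_mem (br_perm _ (perm_map f (perm_enum_imset B hi))).
by rewrite -map_comp.
Qed.

Lemma br_ext_block A x0 n (y : 'I_n.+1 -> A) (B : {set 'I_n}) :
  br x0 [seq y i | i in ord0 |: blift B] =
  qcons (y ord0) (br x0 [seq y (lift ord0 i) | i in B]).
Proof.
rewrite qconsE /image_mem.
rewrite (br_perm _ (perm_map y (perm_enumU1 (negbT (ord0_blift B))))) map_cons -!qconsE.
by congr (qcons _ _); apply: br_imset; apply: lift_inj.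
Qed.

(** A new entry joins a block or starts one of its own. Joining the block B
    turns ⟨x_B⟩ into the same bracket with the entry adjoined, and a new block is
    the base point ⟨x0⟩ with the entry adjoined: these are exactly the terms of
    [qder]. *)
Lemma comult_funS A x0 n (y : 'I_n.+1 -> A) :
  comult_fun x0 y =
  qder idfun (qcons (y ord0)) (comult_fun x0 (fun i => y (lift ord0 i))).
Proof.
rewrite /comult_fun linear_sum.
rewrite (reindex_onto (@ext_part n) (@res_part n)) => [|P' /res_partK //].
rewrite (eq_bigl (fun Po => partition Po.1 [set: 'I_n] && (Po.2 \in set0 |: Po.1)))
  => [|[P o]] /=; last first.
  apply/andP/andP => [[partE /eqP e]|[partP oP]].
    by have := res_partP partE; rewrite e => -[].
  by rewrite ext_partP ?ext_partK.
rewrite -(pair_big_dep (fun P : {set {set 'I_n}} => partition P [set: 'I_n])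
  (fun P o => o \in set0 |: P)
  (fun (P : {set {set 'I_n}}) (o : {set 'I_n}) =>
    br (br x0 [::])
      [seq br x0 [seq y i | i in B] | B : {set 'I_n.+1} in ext_part (P, o)])) /=.
apply: eq_bigr => P partP.
pose f (B : {set 'I_n}) := br x0 [seq y (lift ord0 i) | i in B].
have extE o :
    br (br x0 [::])
      [seq br x0 [seq y i | i in B] | B : {set 'I_n.+1} in ext_part (P, o)] =
    qcons (qcons (y ord0) (f o)) (br (br x0 [::]) [seq f B | B in P :\ o]).
  have ni : ord0 |: blift o \notin [set blift B | B in P :\ o].
    by apply/imsetP => -[B _ /setP/(_ ord0)]; rewrite ord0_blift !inE eqxx.
  rewrite {1}/image_mem (br_perm _ (perm_map _ (perm_enumU1 ni))) map_cons -qconsE.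
  rewrite br_ext_block; congr (qcons _ _).
  rewrite -[X in br _ X]/[seq br x0 [seq y i | i in B]
    | B : {set 'I_n.+1} in [set blift B | B in P :\ o]].
  rewrite br_imset; last exact: can_inj (@bliftK n).
  congr br; apply: eq_map => B; apply: br_imset; exact: lift_inj.
have /and3P[_ _ P0] := partP.
rewrite big_setU1 //= extE qderE qpick_set !linearD !tensmapE !qinsE; congr (_ + _).
  rewrite qmap_id; have -> : P :\ set0 = P.
    by apply/setDidPl; rewrite disjoint_sym disjoints1.
  by rewrite /f /image_mem enum_set0.
rewrite !linear_sum; apply: eq_bigr => B BP.
by rewrite extE tensmapE qinsE qmap_id.
Qed.

Lemma qdup_subproof :
  {F : forall A, {linear Q A -> Q (Q A)} |
   forall A u, F A u = comult A u}.
Proof. by exists (@comult k). Qed.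

Definition qdup A := sval qdup_subproof A.

Lemma qdupE A u : comult A u = qdup A u.
Proof. by rewrite /qdup (svalP qdup_subproof). Qed.

Lemma qdup0 A (x0 : A) : qdup A (br x0 [::]) = br (br x0 [::]) [::].
Proof.
rewrite -qdupE QliftE /comult_fun (big_pred1 set0) => [|P].
  by rewrite /image_mem enum_set0.
apply/idP/eqP => [/partition_setTP[P0 _ _]|->].
  apply/setP => B; rewrite inE; apply: contraNF P0 => BP.
  by suff -> : set0 = B by []; apply/setP => -[].
apply/partition_setTP; split=> [|[]//|B B' []//]; by rewrite inE.
Qed.

Lemma qdup_cons A (x : A) u : qdup A (qcons x u) = qder idfun (qcons x) (qdup A u).
Proof.
move: u; apply: br_klinear_ext => [||x0 s]; try klin.
by rewrite qconsE -!qdupE !QliftE comult_funS.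
Qed.

Lemma qdup_nat U V (p : {linear U -> V}) u :
  qdup V (qmap p u) = qmap (qmap p) (qdup U u).
Proof.
move: u; apply: qcons_klinear_ext => [||x0|x u IH]; try klin.
  by rewrite !(qmap0, qdup0).
rewrite qmap_cons !qdup_cons IH qder_qmap qmap_qder.
by apply: eq_qder => // v; rewrite /= qmap_cons.
Qed.

(** When an entry x is adjoined, [qdup_cons] turns the claim into a statement
    about two successive derivatives, which [qderC] settles. *)
Lemma qdup_qder U V (p d : {linear U -> V}) u :
  qdup V (qder p d u) = qder (qmap p) (qder p d) (qdup U u).
Proof.
move: u; apply: qcons_klinear_ext => [||x0|x u IH]; try klin.
  by rewrite qder0 -qconsE qdup_cons !qdup0 !qder0 qmap0 qconsE.
rewrite qder_cons linearD !qdup_cons IH.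
rewrite (@qderC _ _ _ (qmap p) (qder p d) (qcons (d x) \o qmap p) (qcons x) (qcons (p x)))
  => [|v|v]; [|exact: (qmap_cons p x v)|exact: (qder_cons p d x v)].
congr (_ + _).
by rewrite qdup_nat qder_qmap; apply: eq_qder.
Qed.

End Comult.

(** * Partial isomorphisms and the monoidal structure *)

Section PartialIsos.
Context {k : comPzSemiRingType}.
Context {A B : lSemiModType k}.

Definition tensl (a : A) : {linear B -> A ⊗ B} := slin (tens_linr a).

Lemma tenslE a b : tensl a b = tens a b.
Proof. exact: slinE. Qed.

Definition tensr (b : B) : {linear A -> A ⊗ B} := slin (tens_linl b).

Lemma tensrE a b : tensr b a = tens a b.
Proof. exact: slinE. Qed.

(** The monoidal structure m_⊗ by recursion on the entries of the left factor:
    each is paired either with an entry of the right factor, which is then used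
    up, or with the base point, which is not. This is the choice that [qpick]
    makes. *)
Fixpoint mtens_rec (x0 : A) (s : seq A) : {linear Q B -> Q (A ⊗ B)} :=
  if s is x :: s' then
    qins (A ⊗ B) \o tensmap (tensl x) (mtens_rec x0 s') \o qpick B
  else qmap (tensl x0).

Section Within.
Context (p : nat) (x0 : A) (y0 : B) (y : 'I_p -> B).
Implicit Types S : {set 'I_p}.

Definition into (S : {set 'I_p}) n (t : {ffun 'I_n -> option 'I_p}) :=
  partial_iso t && [forall i, if t i is Some j then j \in S else true].

(** The sum defining m_⊗, with the right entries restricted to S. The
    restriction is what makes a recursion possible: once the first left entry
    is paired with j, the others have to avoid j. *)
Definition mtens_within (S : {set 'I_p}) n (x : 'I_n -> A) : Q (A ⊗ B) :=
  \sum_(t : {ffun 'I_n -> option 'I_p} | into S t)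
    br (tens x0 y0)
      ([seq tens (x i) (if t i is Some j then y j else y0) | i : 'I_n] ++
       [seq tens x0 (y j) | j in S :\: [set j | Some j \in codom t]]).

Definition fcons n (ot : option 'I_p * {ffun 'I_n -> option 'I_p}) :
    {ffun 'I_n.+1 -> option 'I_p} :=
  [ffun i => if unlift ord0 i is Some i' then ot.2 i' else ot.1].

Lemma fcons0 n o (t : {ffun 'I_n -> option 'I_p}) : fcons (o, t) ord0 = o.
Proof. by rewrite ffunE unlift_none. Qed.

Lemma fconsS n o (t : {ffun 'I_n -> option 'I_p}) i :
  fcons (o, t) (lift ord0 i) = t i.
Proof. by rewrite ffunE liftK. Qed.

Lemma fcons_bij n : bijective (@fcons n).
Proof.
exists (fun t : {ffun 'I_n.+1 -> option 'I_p} =>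
  (t ord0, [ffun i => t (lift ord0 i)])) => [[o t]|t].
  by rewrite fcons0; congr pair; apply/ffunP => i; rewrite ffunE fconsS.
apply/ffunP => i; case: (unliftP ord0 i) => [j ->|->].
  by rewrite fconsS ffunE.
by rewrite fcons0.
Qed.

Lemma intoP S n (t : {ffun 'I_n -> option 'I_p}) :
  reflect ((forall i i' j, t i = Some j -> t i' = Some j -> i = i') /\
           forall i j, t i = Some j -> j \in S) (into S t).
Proof.
apply: (iffP andP) => -[tP tS]; split=> //; try exact/partial_isoP.
- by move=> i j ti; move/forallP/(_ i): tS; rewrite ti.
- by apply/forallP => i; case ti: (t i) => [j|] //; apply: tS ti.
Qed.

Lemma into_fcons S n o (t : {ffun 'I_n -> option 'I_p}) :
  into S (fcons (o, t)) =
  if o is Some j then (j \in S) && into (S :\ j) t else into S t.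
Proof.
apply/intoP/idP => [[ti tS]|].
  have tj i j : t i = Some j -> Some j != o /\ j \in S.
    move=> tij; split; last by apply: (tS (lift ord0 i)); rewrite fconsS.
    apply/eqP => jo; suff : lift ord0 i = ord0 by [].
    by apply: (ti _ _ j); rewrite ?fconsS ?fcons0.
  have ti' i i' j : t i = Some j -> t i' = Some j -> i = i'.
    by move=> e e'; apply/(@lift_inj _ ord0)/(ti _ _ j); rewrite fconsS.
  case: o ti tS tj => [o|] ti tS tj.
    rewrite (tS ord0) ?fcons0 //; apply/intoP; split=> // i j /tj[].
    by rewrite !inE => jo ->; rewrite andbT.
  by apply/intoP; split=> // i j /tj[].
have main S' : into S' t -> (forall j, j \in S' -> Some j != o) ->
    (forall i i' j, fcons (o, t) i = Some j -> fcons (o, t) i' = Some j -> i = i').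
  move=> /intoP[ti tS] So i i' j.
  case: (unliftP ord0 i) => [i1 ->|->]; case: (unliftP ord0 i') => [i2 ->|->];
    rewrite ?fcons0 ?fconsS //.
  - by move=> e e'; rewrite (ti _ _ _ e e').
  - by move=> /tS/So/eqP jo /esym.
  - by move=> e /tS/So/eqP jo; case: jo.
case: o main => [o|] main => [/andP[oS tS]|tS]; (split; first apply: (main _ tS)).
- by move=> j; rewrite !inE => /andP[].
- have [_ {}tS] := intoP _ _ tS.
  move=> i j; case: (unliftP ord0 i) => [i1 ->|->]; rewrite ?fcons0 ?fconsS.
    by move/tS; rewrite !inE => /andP[].
  by case=> <-.
- by [].
have [_ {}tS] := intoP _ _ tS.
move=> i j; case: (unliftP ord0 i) => [i1 ->|->]; rewrite ?fcons0 ?fconsS //.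
exact: tS.
Qed.

Lemma codom_fcons n o (t : {ffun 'I_n -> option 'I_p}) j :
  (Some j \in codom (fcons (o, t))) = (Some j == o) || (Some j \in codom t).
Proof.
apply/codomP/orP => [[i]|[/eqP <-|/codomP[i ti]]].
- case: (unliftP ord0 i) => [i' ->|->]; rewrite ?fcons0 ?fconsS => ->.
    by right; apply: codom_f.
  by left.
- by exists ord0; rewrite fcons0.
- by exists (lift ord0 i); rewrite fconsS.
Qed.

Lemma big_option (V : lSemiModType k) (P : pred (option 'I_p)) (F : option 'I_p -> V) :
  P None ->
  \sum_(o | P o) F o = F None + \sum_(j | P (Some j)) F (Some j).
Proof.
move=> P0; rewrite (bigD1 None) //=; congr (_ + _).
rewrite (reindex_omap Some id) => [|[j|]] //.
  by apply: eq_bigl => j; rewrite eqxx !andbT.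
by rewrite andbF.
Qed.

Lemma mtens_withinS S n (x : 'I_n.+1 -> A) :
  mtens_within S x =
  qcons (tens (x ord0) y0) (mtens_within S (fun i => x (lift ord0 i))) +
  \sum_(j in S) qcons (tens (x ord0) (y j))
    (mtens_within (S :\ j) (fun i => x (lift ord0 i))).
Proof.
rewrite /mtens_within (reindex (@fcons n)) /=; last exact/onW_bij/fcons_bij.
pose ok (o : option 'I_p) := if o is Some j then j \in S else true.
pose S' (o : option 'I_p) := if o is Some j then S :\ j else S.
rewrite (eq_bigl (fun ot => ok ot.1 && into (S' ot.1) ot.2)); last first.
  by case=> [o t]; rewrite into_fcons; case: o.
rewrite -(pair_big_dep ok (fun o t => into (S' o) t) 
  (fun o t => br (tens x0 y0)
      ([seq tens (x i) (if fcons (o, t) i is Some j then y j else y0) | i : 'I_n.+1] ++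
       [seq tens x0 (y j) | j in S :\: [set j | Some j \in codom (fcons (o, t))]]))) /=.
rewrite big_option //=.
have entriesE o (t : {ffun 'I_n -> option 'I_p}) :
  br (tens x0 y0)
      ([seq tens (x i) (if fcons (o, t) i is Some j then y j else y0) | i : 'I_n.+1] ++
       [seq tens x0 (y j) | j in S :\: [set j | Some j \in codom (fcons (o, t))]]) =
  qcons (tens (x ord0) (if o is Some j then y j else y0)) (br (tens x0 y0)
      ([seq tens (x (lift ord0 i)) (if t i is Some j then y j else y0) | i : 'I_n] ++
       [seq tens x0 (y j) | j in S' o :\: [set j | Some j \in codom t]])).
  rewrite qconsE -cat_cons; congr (br _ (_ ++ _)).
    rewrite /image_mem enum_ordSl map_cons fcons0 -map_comp; congr (_ :: _).
    by apply: eq_map => i /=; rewrite fconsS.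
  congr map; apply: eq_enum => j; rewrite !inE codom_fcons.
  case: o => [o|] //=; rewrite !inE (inj_eq Some_inj).
  by case: (j == o); case: (_ \in codom t).
congr (_ + _); first by rewrite linear_sum; apply: eq_bigr => t _; rewrite entriesE.
by apply: eq_bigr => j _; rewrite linear_sum; apply: eq_bigr => t _; rewrite entriesE.
Qed.

Lemma mtens_withinE S n (x : 'I_n -> A) :
  mtens_within S x = mtens_rec x0 [seq x i | i : 'I_n] (br y0 [seq y j | j in S]).
Proof.
elim: n S x => [|n IH] S x.
  have e0 : enum 'I_0 = [::] by apply: size0nil; rewrite size_enum_ord.
  have n0 (t : {ffun 'I_0 -> option 'I_p}) j : (Some j \in codom t) = false.
    by apply/codomP => -[[]].
  rewrite /mtens_within (big_pred1 [ffun=> None]) => [|t].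
    rewrite /image_mem e0 /= qmapE tenslE -map_comp.
    congr br; rewrite (@eq_enum _ _ (mem S)) => [|j]; last by rewrite !inE n0.
    by apply: eq_map => j; rewrite /= tenslE.
  rewrite (_ : t = [ffun=> None]); last by apply/ffunP => -[].
  by rewrite /= eqxx; apply/intoP; split=> -[].
have -> : [seq x i | i : 'I_n.+1] = x ord0 :: [seq x (lift ord0 i) | i : 'I_n].
  by rewrite {1}/image_mem enum_ordSl map_cons -map_comp.
rewrite mtens_withinS IH /= qpick_set !linearD !tensmapE !qinsE !tenslE; congr (_ + _).
rewrite !linear_sum; apply: eq_bigr => j _.
by rewrite IH tensmapE qinsE tenslE.
Qed.

End Within.

Lemma mtens_br x0 s (w : Q B) : mtens A B (tens (br x0 s) w) = mtens_rec x0 s w.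
Proof.
move: w; apply: br_klinear_ext => [||y0 ys].
- by apply: klinear_comp; [exact: linear_klinear|exact: tens_linr].
- exact: linear_klinear.
have brE (C : lSemiModType k) (zs : seq C) :
    [seq nth 0 zs (nat_of_ord i) | i : 'I_(size zs)] = zs.
  rewrite -[RHS](mkseq_nth 0) /mkseq -val_enum_ord -map_comp; exact: eq_map.
rewrite mtensE -[s in RHS](brE A s) -[ys in RHS](brE B ys).
have -> : [seq nth 0 ys (nat_of_ord i) | i : 'I_(size ys)] =
    [seq nth 0 ys (nat_of_ord i) | i in [set: 'I_(size ys)]].
  by congr map; apply: eq_enum => i; rewrite !inE.
rewrite -mtens_withinE; apply: eq_big => [t|t _].
  rewrite /into andbC; case: forallP => // -[] i; case: (t i) => [j|] //.
  by rewrite inE.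
congr (br _ (_ ++ _)); congr map; apply: eq_enum => j; by rewrite !inE andbT.
Qed.

Lemma qtens_subproof :
  {F : {linear Q A ⊗ Q B -> Q (A ⊗ B)} | forall w, F w = mtens A B w}.
Proof. by exists (mtens A B). Qed.

Definition qtens := sval qtens_subproof.

Lemma qtens_mtens w : mtens A B w = qtens w.
Proof. by rewrite /qtens (svalP qtens_subproof). Qed.

Lemma qtens0 x0 w : qtens (tens (br x0 [::]) w) = qmap (tensl x0) w.
Proof. by rewrite -qtens_mtens mtens_br. Qed.

End PartialIsos.

(** * The fusion map *)

Section Fusion.
Context {k : comPzSemiRingType}.
Implicit Types A B C U V : lSemiModType k.

Lemma qtens_cons A B (x : A) t (w : Q B) :
  qtens (tens (qcons x t) w) =
  qins _ (tensmap (tensl x) (qtens \o tensl t) (qpick B w)).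
Proof.
move: t; apply: br_klinear_ext.
- split=> [c a|a b]; first by rewrite linearZ (tens_linl _).1 linearZ.
  by rewrite linearD (tens_linl _).2 linearD.
- apply: klinear_comp; first exact: linear_klinear.
  apply: (@tensmap_klinearr _ _ _ _ _ _ _ (fun t => qtens \o tensl t)) => u.
  split=> [c a|a b]; rewrite /= !tenslE.
    by rewrite (tens_linl _).1 linearZ.
  by rewrite (tens_linl _).2 linearD.
move=> x0 s; rewrite qconsE -qtens_mtens mtens_br /=.
congr (qins _ _); apply: eq_tensmap => // u.
by rewrite /= tenslE -qtens_mtens mtens_br.
Qed.

Lemma qtens_klinearl A B (w : Q B) : klinear (fun t : Q A => qtens (tens t w)).
Proof.
split=> [c a|a b]; first by rewrite (tens_linl _).1 linearZ.
by rewrite (tens_linl _).2 linearD.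
Qed.

Lemma qtens_klinearr A B (t : Q A) : klinear (fun w : Q B => qtens (tens t w)).
Proof.
split=> [c a|a b]; first by rewrite (tens_linr _).1 linearZ.
by rewrite (tens_linr _).2 linearD.
Qed.

(** Nothing can be paired with a right factor that has no entries. *)
Lemma qtens_br0 A B (y0 : B) (t : Q A) :
  qtens (tens t (br y0 [::])) = qmap (tensr y0) t.
Proof.
move: t; apply: qcons_klinear_ext => [||x0|x t IH]; first exact: qtens_klinearl.
- klin.
- by rewrite qtens0 !qmap0 tenslE tensrE.
by rewrite qtens_cons qpick0 tensmapE qinsE qmap_cons /= !tenslE tensrE IH.
Qed.

Lemma tensmap_tensl A B U (p : {linear B -> U}) (x : A) v :
  tensmap idfun p (tensl x v) = tensl x (p v).
Proof. by rewrite !tenslE tensmapE. Qed.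

Lemma qtens_nat A B U (p : {linear B -> U}) (t : Q A) w :
  qtens (tens t (qmap p w)) = qmap (tensmap idfun p) (qtens (tens t w)).
Proof.
move: t; apply: br_klinear_ext => [||x0 s]; first exact: qtens_klinearl.
  exact/lin_klinear/qtens_klinearl.
elim: s w => [|x s IH] w.
  by rewrite !qtens0 !qmap_comp; apply: eq_qmap => v; rewrite /= tensmap_tensl.
rewrite -qconsE !qtens_cons qpick_nat qins_nat !tensmap_comp; congr (qins _ _).
apply: eq_tensmap => v; rewrite /= ?tensmap_tensl //.
by rewrite !tenslE IH.
Qed.

(** By induction on the entries of t, for all w at once: the recursion
    [qtens_cons] calls m_⊗ on what [qpick] leaves of w, and [qpick_qder]
    describes [qpick] of a derivative. *)
Lemma qtens_qder A U V (p d : {linear U -> V}) (t : Q A) w :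
  qtens (tens t (qder p d w)) =
  qder (tensmap idfun p) (tensmap idfun d) (qtens (tens t w)).
Proof.
move: t; apply: br_klinear_ext => [||x0 s]; first exact: qtens_klinearl.
  exact/lin_klinear/qtens_klinearl.
elim: s w => [|x s IH] w.
  rewrite !qtens0 qmap_qder qder_qmap; apply: eq_qder => v;
  by rewrite /= tensmap_tensl.
rewrite -qconsE !qtens_cons qpick_qder qder_ins !linearD !tensmap_comp.
congr (qins _ _ + qins _ _); apply: eq_tensmap => v; rewrite /= ?tensmap_tensl //.
  by rewrite !tenslE IH.
by rewrite !tenslE qtens_nat.
Qed.

(** Q m after the fusion map. When m is a composition law, this composes the
    formal elements t and s. *)
Definition qsubst A B C (m : {linear A ⊗ Q B -> C}) (t : Q A) (s : Q B) : Q C :=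
  qmap m (qtens (tens t (qdup B s))).

Lemma Qmap_qmap U V (f : {linear U -> V}) u : Qmap f u = qmap f u.
Proof.
move: u; apply: Qext => x0 n x; rewrite -br_codom qmapE br_codom QliftE.
rewrite /Qmap_fun -br_codom; congr br.
by rewrite -map_comp.
Qed.

Lemma qsubst_fusion (A B C D : lSemiModType k) (m : {linear A ⊗ Q B -> C}) (h : D)
    (t : Q A) (s : Q B) :
  tmap idfun (Qmap m) (tmap idfun (fusion A B) (tassoc D _ _ (tens (tens h t) s))) =
  tens h (qsubst m t s).
Proof.
rewrite tassocE tmapE tmapE /fusion Qmap_qmap /qsubst; congr (tens h (qmap m _)).
by rewrite -qtens_mtens -qdupE -(tmapE idfun (comult B)).
Qed.

Lemma qsubst_br0 A B C (m : {linear A ⊗ Q B -> C}) t y0 :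
  qsubst m t (br y0 [::]) = qmap (m \o tensr (br y0 [::])) t.
Proof. by rewrite /qsubst qdup0 qtens_br0 qmap_comp. Qed.

Lemma qsubst0_br A B C (m : {linear A ⊗ Q B -> C}) x0 s :
  qsubst m (br x0 [::]) s = qmap (m \o tensl x0) (qdup B s).
Proof. by rewrite /qsubst qtens0 qmap_comp. Qed.

Lemma qsubst_klinearr A B C (m : {linear A ⊗ Q B -> C}) t :
  klinear (fun s => qsubst m t s).
Proof.
apply: lin_klinear.
exact: (klinear_comp (qtens_klinearr _ t) (linear_klinear (qdup B))).
Qed.

(** A single entry is a first-order displacement of the base point. *)
Lemma qsubst_br1 (U V W : lSemiModType k) (m : {linear U ⊗ Q V -> W}) t x y :
  qsubst m t (br x [:: y]) =
  qder (m \o tensr (br x [::])) (m \o tensr (br x [:: y])) t.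
Proof.
rewrite /qsubst -qconsE qdup_cons qdup0 qtens_qder qtens_br0 qder_qmap qmap_qder.
by apply: eq_qder => u; rewrite /= !tensrE tensmapE // qconsE.
Qed.

(** The chain rule for substitution: if p' and d' act on the values of m as p
    and [qder p d] act on its second argument, then the derivative of a
    substitution is computed on s. *)
Lemma qsubst_qder A B B' C C' (m : {linear A ⊗ Q B -> C})
    (m' : {linear A ⊗ Q B' -> C'}) (p d : {linear B -> B'}) (p' d' : {linear C -> C'}) t s :
  (forall g u, p' (m (tens g u)) = m' (tens g (qmap p u))) ->
  (forall g u, d' (m (tens g u)) = m' (tens g (qder p d u))) ->
  qsubst m' t (qder p d s) = qder p' d' (qsubst m t s).
Proof.
move=> pm dm; rewrite /qsubst qdup_qder qtens_qder qmap_qder qder_qmap.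
apply: eq_qder; apply: tens_klinear_ext => [||a b]; try klin;
by rewrite /= tensmapE ?pm ?dm.
Qed.

End Fusion.

(** * Directional derivatives in a cartesian differential category *)

Section CLL.
Context {k : comPzSemiRingType} {G : kgraph k} {P : products G} (C : cllcat P).
Local Notation "g ∘ f" := (mcomp C g f) (at level 40, left associativity).
Local Notation "⟪ f , g ⟫" := (mpair C f g).

Lemma pi0_klinear (X A B : G) : klinear (fun h : hom X (prd P A B) => pi0 P ∘ h).
Proof.
by have [lZ lD] := pair_lin C X A B; split=> [a h|h h'];
  [case: (lZ a h)|case: (lD h h')].
Qed.

Lemma pi1_klinear (X A B : G) : klinear (fun h : hom X (prd P A B) => pi1 P ∘ h).
Proof.
by have [lZ lD] := pair_lin C X A B; split=> [a h|h h'];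
  [case: (lZ a h)|case: (lD h h')].
Qed.

Lemma pair_ext (X A B : G) (h h' : hom X (prd P A B)) :
  pi0 P ∘ h = pi0 P ∘ h' -> pi1 P ∘ h = pi1 P ∘ h' -> h = h'.
Proof. by move=> /pair_uniq/[apply] ->; apply/esym/pair_uniq. Qed.

Lemma pairZ (X A B : G) a (f : hom X A) (g : hom X B) :
  ⟪a *: f, a *: g⟫ = a *: ⟪f, g⟫.
Proof.
apply: pair_ext; rewrite ?(pi0_klinear _ _ _).1 ?(pi1_klinear _ _ _).1;
by rewrite ?pair_pi0 ?pair_pi1.
Qed.

Lemma pairD (X A B : G) (f f' : hom X A) (g g' : hom X B) :
  ⟪f + f', g + g'⟫ = ⟪f, g⟫ + ⟪f', g'⟫.
Proof.
apply: pair_ext; rewrite ?(pi0_klinear _ _ _).2 ?(pi1_klinear _ _ _).2;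
by rewrite ?pair_pi0 ?pair_pi1.
Qed.

Lemma pair0 (X A B : G) : ⟪0, 0⟫ = 0 :> hom X (prd P A B).
Proof.
by apply: pair_ext; rewrite ?pair_pi0 ?pair_pi1;
  rewrite (klinear_eq0 (pi0_klinear _ _ _), klinear_eq0 (pi1_klinear _ _ _)).
Qed.

Lemma pair_eta (X A B : G) (h : hom X (prd P A B)) : ⟪pi0 P ∘ h, pi1 P ∘ h⟫ = h.
Proof. by apply: pair_ext; rewrite ?pair_pi0 ?pair_pi1. Qed.

Lemma pair_id (A B : G) : ⟪pi0 P, pi1 P⟫ = idm (prd P A B).
Proof. by rewrite -[RHS]pair_eta !comp_idr. Qed.

Definition precomp (X Y Z : G) (a : hom Z X) : {linear hom X Y -> hom Z Y} :=
  slin (comp_linl C Y a).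

Lemma precompE (X Y Z : G) (a : hom Z X) (f : hom X Y) : precomp Y a f = f ∘ a.
Proof. exact: slinE. Qed.

End CLL.

Section CDCTheory.
Context {k : comPzSemiRingType} {G : kgraph k} {P : products G} (C : cdc P).
Local Notation "g ∘ f" := (mcomp C g f) (at level 40, left associativity).
Local Notation "⟪ f , g ⟫" := (mpair C f g).

Lemma dird_subproof (X Y Z : G) (a b : hom Z X) :
  klinear (fun f : hom X Y => diff C f ∘ ⟪a, b⟫).
Proof.
exact: (klinear_comp (comp_linl C Y ⟪a, b⟫) (diff_lin (diffP C) X Y)).
Qed.

(** The derivative of f at the point a in the direction b, as a linear operator
    on the maps f. *)
Definition dird (X Y Z : G) (a b : hom Z X) : {linear hom X Y -> hom Z Y} :=
  slin (dird_subproof Y a b).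

Lemma dirdE (X Y Z : G) (a b : hom Z X) (f : hom X Y) :
  dird Y a b f = diff C f ∘ ⟪a, b⟫.
Proof. exact: slinE. Qed.

Lemma dird_comp_r (X Y Z W : G) (a b : hom Z X) (c : hom W Z) (f : hom X Y) :
  dird Y a b f ∘ c = dird Y (a ∘ c) (b ∘ c) f.
Proof. by rewrite !dirdE -comp_assoc comp_pair. Qed.

Lemma dird_comp (X Y Z W : G) (a b : hom Z X) (g : hom Y W) (f : hom X Y) :
  dird W a b (g ∘ f) = dird W (f ∘ a) (dird Y a b f) g.
Proof.
rewrite !dirdE (diff_comp (diffP C)) -comp_assoc comp_pair -comp_assoc.
by rewrite pair_pi0.
Qed.

Lemma dird_pi0 (A B Z : G) (a b : hom Z (prd P A B)) :
  dird A a b (pi0 P) = pi0 P ∘ b.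
Proof. by rewrite dirdE (diff_pi0 (diffP C)) -comp_assoc pair_pi1. Qed.

Lemma dird_pi1 (A B Z : G) (a b : hom Z (prd P A B)) :
  dird B a b (pi1 P) = pi1 P ∘ b.
Proof. by rewrite dirdE (diff_pi1 (diffP C)) -comp_assoc pair_pi1. Qed.

Lemma dird_id (A Z : G) (a b : hom Z A) : dird A a b (idm A) = b.
Proof. by rewrite dirdE (diff_id (diffP C)) pair_pi1. Qed.

Lemma dird_klinear (X Y Z : G) (a : hom Z X) (f : hom X Y) :
  klinear (fun b : hom Z X => dird Y a b f).
Proof.
split=> [c b|b b']; rewrite !dirdE.
  have := diff_linr (diffP C) f a b 0 c 0.
  by rewrite !scale0r !addr0.
by have := diff_linr (diffP C) f a b b' 1 1; rewrite !scale1r.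
Qed.

Lemma dird0 (X Y Z : G) (a : hom Z X) (f : hom X Y) : dird Y a 0 f = 0.
Proof. exact: (klinear_eq0 (dird_klinear a f)). Qed.

(** Since the projections have constant derivative, the chain rule applied to
    their composites with the pair determines its derivative. *)
Lemma dird_pair (X A B Z : G) (a b : hom Z X) (f : hom X A) (g : hom X B) :
  dird _ a b ⟪f, g⟫ = ⟪dird _ a b f, dird _ a b g⟫.
Proof.
apply: (pair_ext (C := C)); rewrite ?pair_pi0 ?pair_pi1.
  by rewrite -(dird_pi0 (⟪f, g⟫ ∘ a)) -dird_comp pair_pi0.
by rewrite -(dird_pi1 (⟪f, g⟫ ∘ a)) -dird_comp pair_pi1.
Qed.

Definition dird2 (X Y Z : G) (a b c : hom Z X) (f : hom X Y) : hom Z Y :=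
  diff C (diff C f) ∘ ⟪⟪a, b⟫, ⟪c, 0⟫⟫.

Lemma dird2C (X Y Z : G) (a b c : hom Z X) (f : hom X Y) :
  dird2 a b c f = dird2 a c b f.
Proof. exact: (diff_diff_sym (diffP C)). Qed.

(** Df is differentiated at (a, b), and the direction splits as a sum along the
    two factors. Along the first this is a second partial derivative, symmetric
    by [dird2C]; along the second Df is linear. *)
Lemma dird_dird (X Y Z W : G) (a b : hom Z X) (c d : hom W Z) (f : hom X Y) :
  dird _ c d (dird _ a b f) =
  dird2 (a ∘ c) (b ∘ c) (dird _ c d a) f + dird Y (a ∘ c) (dird _ c d b) f.
Proof.
rewrite [dird _ a b f]dirdE dird_comp dird_pair comp_pair.
have -> : ⟪dird _ c d a, dird _ c d b⟫ = ⟪dird _ c d a, 0⟫ + ⟪0, dird _ c d b⟫.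
  by rewrite -pairD addr0 add0r.
rewrite (dird_klinear _ _).2; congr (_ + _); first by rewrite dirdE.
by rewrite [LHS]dirdE (diff_diff_lin (diffP C)) -dirdE.
Qed.

Lemma eq_tup_le (X A : G) n (x y : nat -> hom X A) :
  (forall i, (i <= n)%N -> x i = y i) -> tup C n x = tup C n y.
Proof.
elim: n => [|n IH] xy /=; first exact: xy.
by rewrite (xy n.+1) // IH // => i /leqW; apply: xy.
Qed.

Lemma dird_tup (X A Z : G) (a b : hom Z X) n (x : nat -> hom X A) :
  dird _ a b (tup C n x) = tup C n (fun i => dird _ a b (x i)).
Proof. by elim: n => //= n IH; rewrite dird_pair IH. Qed.

Definition tup0 (X A : G) n (v : hom X A) : hom X (tpow (P := P) A n) :=
  tup C n (fun i => if i is 0 then v else 0).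

Lemma tup0_klinear (X A : G) n : klinear (@tup0 X A n).
Proof.
elim: n => [|n [IHZ IHD]]; first exact: klinear_id.
split=> [a x|x y]; rewrite /tup0 /= -!/(tup0 _ _).
  by rewrite IHZ -pairZ scaler0.
by rewrite IHD -pairD addr0.
Qed.

Lemma comp_tup0 (W X A : G) n (v : hom X A) (h : hom W X) :
  tup0 n v ∘ h = tup0 n (v ∘ h).
Proof. by rewrite /tup0 comp_tup; apply: eq_tup => -[|i] //; rewrite comp0. Qed.

Lemma dird_tup0 (X A Z : G) (a b : hom Z X) n (v : hom X A) :
  dird _ a b (tup0 n v) = tup0 n (dird _ a b v).
Proof. by rewrite /tup0 dird_tup; apply: eq_tup => -[|i] //; rewrite linear0. Qed.

Lemma derS_dird (X A B : G) (g : hom A B) n (x : nat -> hom X A) :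
  der C g n.+1 ∘ tup C n.+1 x = dird _ (tup C n x) (tup0 n (x n.+1)) (der C g n).
Proof. by rewrite derS dirdE. Qed.

Lemma der_dird (A B : G) (g : hom A B) n :
  der C g n.+1 = dird _ (pi0 P) (tup0 n (pi1 P)) (der C g n).
Proof. by rewrite dirdE. Qed.

Definition derl (X A B : G) (g : hom A B) (f0 : hom X A) (s : seq (hom X A)) : hom X B :=
  der C g (size s) ∘ tup C (size s) (nth 0 (f0 :: s)).

Lemma derl_nil (X A B : G) (g : hom A B) (f0 : hom X A) : derl g f0 [::] = g ∘ f0.
Proof. by []. Qed.

Lemma derl_rcons (X A B : G) (g : hom A B) (f0 : hom X A) s v :
  derl g f0 (rcons s v) =
  dird _ (tup C (size s) (nth 0 (f0 :: s))) (tup0 (size s) v) (der C g (size s)).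
Proof.
rewrite /derl size_rcons derS_dird; congr (dird _ _ _ _).
  by apply: eq_tup_le => -[|i] //= lei; rewrite nth_rcons lei.
by rewrite /= nth_rcons ltnn eqxx.
Qed.

Lemma derl_comp (X A B Z : G) (g : hom A B) (f0 : hom X A) s (a : hom Z X) :
  derl g f0 s ∘ a = derl g (f0 ∘ a) [seq f ∘ a | f <- s].
Proof.
rewrite /derl -comp_assoc comp_tup size_map; congr (_ ∘ _); apply: eq_tup_le.
by move=> [|i] //= lei; rewrite (nth_map 0).
Qed.

(** If the entries have derivative 0, then only the base point moves, and the
    derivative of g^(n) is by definition g^(n+1) with its last argument the
    displacement. *)
Lemma dird_derl (X A B Z : G) (g : hom A B) (f0 : hom X A) s (a b : hom Z X) :
  (forall f, f \in s -> dird _ a b f = 0) ->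
  dird _ a b (derl g f0 s) = derl g (f0 ∘ a) (rcons [seq f ∘ a | f <- s] (dird _ a b f0)).
Proof.
move=> s0; rewrite derl_rcons /derl dird_comp comp_tup dird_tup size_map.
congr (dird _ _ _ _); apply: eq_tup_le => -[|i] //= lei; first by rewrite (nth_map 0).
exact/s0/mem_nth.
Qed.

(** The point f displaced by a new variable. Differentiating in that
    variable along v, at the value 0, gives v here and 0 on whatever does not
    involve the variable; this is [dird_var]. In this way a derivative with n + 1
    entries becomes a first derivative of one with n entries
    ([derl_rcons_var]). *)
Definition shift_var (X A : G) (f : hom X A) : hom (prd P X A) A := f ∘ pi0 P + pi1 P.

Definition dird_var (X A B Z : G) (a : hom Z X) (v : hom Z A) :
    {linear hom (prd P X A) B -> hom Z B} :=
  dird B ⟪a, 0⟫ ⟪0, v⟫.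

Lemma dird_var_pi0 (X A Y Z : G) (a : hom Z X) (v : hom Z A) (f : hom X Y) :
  dird_var Y a v (f ∘ pi0 P) = 0.
Proof. by rewrite /dird_var dird_comp dird_pi0 !pair_pi0 dird0. Qed.

Lemma dird_var_shift (X A Z : G) (a : hom Z X) (v : hom Z A) (f : hom X A) :
  dird_var A a v (shift_var f) = v.
Proof. by rewrite linearD dird_var_pi0 /dird_var dird_pi1 pair_pi1 add0r. Qed.

Lemma shift_var_pair0 (X A Z : G) (a : hom Z X) (f : hom X A) :
  shift_var f ∘ ⟪a, 0⟫ = f ∘ a.
Proof. by rewrite (comp_linl C _ _).2 -comp_assoc pair_pi0 pair_pi1 addr0. Qed.

Lemma dird_var_derl (X A B Z : G) (g : hom A B) (f0 : hom X A) s (a : hom Z X) v :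
  dird_var B a v (derl g (shift_var f0) [seq f ∘ pi0 P | f <- s]) =
  derl g (f0 ∘ a) (rcons [seq f ∘ a | f <- s] v).
Proof.
rewrite /dird_var dird_derl => [|_ /mapP[f _ ->]]; last exact: dird_var_pi0.
rewrite shift_var_pair0 dird_var_shift -map_comp; congr (derl _ _ (rcons _ _)).
by apply: eq_map => f /=; rewrite -comp_assoc pair_pi0.
Qed.

Lemma derl_rcons_var (X A B : G) (g : hom A B) (f0 : hom X A) s v :
  derl g f0 (rcons s v) = dird_var B (idm X) v
    (derl g (shift_var f0) [seq f ∘ pi0 P | f <- s]).
Proof.
rewrite dird_var_derl comp_idr; congr (derl _ _ (rcons _ _)).
by rewrite -[LHS]map_id; apply: eq_map => f; rewrite comp_idr.
Qed.

Lemma tup_rcons (X A : G) (f0 : hom X A) s x :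
  tup C (size s).+1 (nth 0 (f0 :: rcons s x)) = ⟪tup C (size s) (nth 0 (f0 :: s)), x⟫.
Proof.
rewrite /= nth_rcons ltnn eqxx; congr mpair.
by apply: eq_tup_le => -[|i] //= lei; rewrite nth_rcons lei.
Qed.

Lemma tup0S (X A : G) n (v : hom X A) : tup0 n.+1 v = ⟪tup0 n v, 0⟫.
Proof. by []. Qed.

(** Both sides are a second partial derivative of g^(n), where n is the size of
    s. *)
Lemma derl_swap_last (X A B : G) (g : hom A B) (f0 : hom X A) s x y :
  derl g f0 (rcons (rcons s x) y) = derl g f0 (rcons (rcons s y) x).
Proof.
suff E x' y' : derl g f0 (rcons (rcons s x') y') =
    dird2 (tup C (size s) (nth 0 (f0 :: s))) (tup0 (size s) x') (tup0 (size s) y')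
      (der C g (size s)) by rewrite !E dird2C.
rewrite derl_rcons size_rcons tup_rcons der_dird dird_dird dird_tup0 dird_pi0 dird_pi1.
rewrite comp_tup0 tup0S !pair_pi0 !pair_pi1 (klinear_eq0 (tup0_klinear _ _ _)).
by rewrite dird0 addr0.
Qed.

End CDCTheory.

(** * The action of higher derivatives on formal elements *)

Section CDCAction.
Context {k : comPzSemiRingType} {G : kgraph k} {P : products G} (C : cdc P).
Local Notation "g ∘ f" := (mcomp C g f) (at level 40, left associativity).
Local Notation "⟪ f , g ⟫" := (mpair C f g).

Lemma derl_swap (X A B : G) (g : hom A B) (f0 : hom X A) s1 x y s2 :
  derl C g f0 (s1 ++ x :: y :: s2) = derl C g f0 (s1 ++ y :: x :: s2).
Proof.
have [n] := ubnP (size s2); elim: n => // n IHn in X f0 s1 x y s2 *.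
case/lastP: s2 => [_|s2 z].
  by rewrite -!cat_rcons !cats0 derl_swap_last.
rewrite size_rcons ltnS => sz.
rewrite -!rcons_cons -!rcons_cat !derl_rcons_var !map_cat !map_cons.
by rewrite IHn ?size_map.
Qed.

Lemma derl_perm (X A B : G) (g : hom A B) (f0 : hom X A) s t :
  perm_eq s t -> derl C g f0 s = derl C g f0 t.
Proof.
suff H : perm_eq s t -> forall r, derl C g f0 (r ++ s) = derl C g f0 (r ++ t).
  by move/H/(_ [::]).
elim/perm_eq_ind => {s t} [|x s t IH r|x y s r|s t u st tu r] //.
- by rewrite -!cat_rcons IH.
- exact: derl_swap.
- by rewrite st.
Qed.

Lemma derl_cons_klinear (X A B : G) (g : hom A B) (f0 : hom X A) s :
  klinear (fun x => derl C g f0 (x :: s)).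
Proof.
apply: klinear_ext (klinear_comp
  (dird_klinear C (tup C (size s) (nth 0 (f0 :: s))) (der C g (size s)))
  (tup0_klinear C X A (size s))) => x.
by rewrite -derl_rcons; apply: derl_perm; rewrite perm_rcons.
Qed.

Lemma der_klinear (A B : G) n : klinear (fun g : hom A B => der C g n).
Proof.
elim: n => [|n IH]; first exact: klinear_id.
apply: klinear_ext (lin_klinear (dird C B (pi0 P) (tup0 C n (pi1 P))) IH) => g.
by rewrite der_dird.
Qed.

Lemma derl_klinear (X A B : G) (f0 : hom X A) s :
  klinear (fun g : hom A B => derl C g f0 s).
Proof. exact: (klinear_comp (comp_linl C _ _) (der_klinear _ _ _)). Qed.

Lemma cdcm_subproof (X Y Z : G) :
  {m : {linear hom Y Z ⊗ Q (hom X Y) -> hom X Z} |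
   forall g f0 s, m (tens g (br f0 s)) = derl C g f0 s}.
Proof.
pose F g : {linear Q (hom X Y) -> hom X Z} :=
  Llift (fun f0 => @derl_cons_klinear X Y Z g f0) (fun f0 => @derl_perm X Y Z g f0).
have FE g f0 s : F g (br f0 s) = derl C g f0 s by apply: LliftE.
have Fl u : klinear (F^~ u).
  split=> [c g|g g']; move: u; apply: br_klinear_ext => [||f0 s]; try klin.
  - exact/klinearZ/linear_klinear.
  - by rewrite !FE (derl_klinear _ _ _).1.
  - by apply: klinearD; apply: linear_klinear.
  - by rewrite !FE (derl_klinear _ _ _).2.
exists (tlift (f := F) Fl (fun g => linear_klinear (F g))) => g f0 s.
by rewrite tliftE FE.
Qed.

Definition cdcm (X Y Z : G) := sval (cdcm_subproof X Y Z).

Lemma cdcmE (X Y Z : G) (g : hom Y Z) (f0 : hom X Y) s :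
  cdcm X Y Z (tens g (br f0 s)) = derl C g f0 s.
Proof. exact: (svalP (cdcm_subproof X Y Z)). Qed.

Lemma cdcm_klinear (X Y Z : G) (g : hom Y Z) :
  klinear (fun t => cdcm X Y Z (tens g t)).
Proof. exact/lin_klinear/tens_linr. Qed.

Lemma cdcm_comp (X Y Z W : G) (g : hom Y Z) t (a : hom W X) :
  precomp C Z a (cdcm X Y Z (tens g t)) = cdcm W Y Z (tens g (qmap (precomp C Y a) t)).
Proof.
move: t; apply: br_klinear_ext => [||f0 s].
- exact: (lin_klinear _ (cdcm_klinear _ g)).
- exact: (klinear_comp (cdcm_klinear _ g) (linear_klinear (qmap (precomp C Y a)))).
rewrite qmapE !cdcmE !precompE derl_comp; congr (derl _ _ _ _).
by apply: eq_map => f; rewrite precompE.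
Qed.

(** Formal elements in which only the base point moves to first order, so that
    [dird_derl] applies to each summand. The summands of a [qder] at a displaced
    point are of this kind. *)
Inductive shift_like (X A W : G) (v : hom W A) (a b : hom W X) : Q (hom X A) -> Prop :=
| shift_like_br f0 s : dird C A a b f0 = v -> (forall f, f \in s -> dird C A a b f = 0) ->
    shift_like v a b (br f0 s)
| shift_like_add t u : shift_like v a b t -> shift_like v a b u -> shift_like v a b (t + u).

Lemma shift_like_qcons (X A W : G) (v : hom W A) (a b : hom W X) f t :
  dird C A a b f = 0 -> shift_like v a b t -> shift_like v a b (qcons f t).
Proof.
move=> f0; elim=> {t} [g s g0 s0|t u _ IHt _ IHu]; last first.
  by rewrite linearD; apply: shift_like_add.
rewrite qconsE; apply: shift_like_br => // h; rewrite inE => /orP[/eqP->|/s0 //].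
exact: f0.
Qed.

Lemma dird_shift_like (X A B W : G) (g : hom A B) (v : hom W A) (a b : hom W X) t :
  shift_like v a b t ->
  dird C B a b (cdcm X A B (tens g t)) =
  cdcm W A B (tens g (qcons v (qmap (precomp C A a) t))).
Proof.
elim=> {t} [f0 s f0v s0|t u _ IHt _ IHu]; last first.
  by rewrite (tens_linr _).2 !linearD IHt IHu (tens_linr _).2 linearD.
rewrite qmapE qconsE !cdcmE dird_derl // f0v precompE; apply: derl_perm.
rewrite perm_rcons; apply/seq.permP => r /=; congr (_ + _)%N.
by congr (count r _); apply: eq_map => f; rewrite precompE.
Qed.

(** The chain rule for higher derivatives. By induction on the number of
    entries: the last entry v is a derivative in a new variable, and the two
    derivatives are exchanged by [dird_dird]; its linear term is the one in which
    v itself is differentiated. *)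
Lemma dird_cdcm (X A B Z : G) (g : hom A B) t (a b : hom Z X) :
  dird C B a b (cdcm X A B (tens g t)) =
  cdcm Z A B (tens g (qder (precomp C A a) (dird C A a b) t)).
Proof.
move: t; apply: br_klinear_ext => [||f0 s].
- exact: (lin_klinear _ (cdcm_klinear _ g)).
- exact: (klinear_comp (cdcm_klinear _ g) (linear_klinear (qder _ (dird C A a b)))).
have [n] := ubnP (size s); elim: n => // n IHn in X Z a b f0 s *.
case/lastP: s => [_|s v].
  rewrite qder0 !cdcmE derl_nil dird_comp precompE.
  by rewrite -[[:: _]]/(rcons [::] _) derl_rcons.
rewrite size_rcons ltnS => sz.
pose phi := cdcm _ A B (tens g (br (shift_var C f0) [seq f ∘ pi0 P | f <- s])).
have -> : br f0 (rcons s v) = qcons v (br f0 s).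
  by rewrite qconsE; apply: br_perm; rewrite perm_rcons.
rewrite qder_cons (tens_linr _).2 linearD qconsE.
have -> : cdcm X A B (tens g (br f0 (v :: s))) = dird_var C B (idm X) v phi.
  by rewrite /phi !cdcmE -derl_rcons_var; apply: derl_perm; rewrite perm_sym perm_rcons.
rewrite /dird_var dird_dird !comp_pair !comp0 comp_idl !dird_pair dird_id !linear0 dird2C.
congr (_ + _); last first.
  rewrite /phi cdcmE dird_var_derl qmapE qconsE cdcmE precompE; apply: derl_perm.
  rewrite perm_rcons; apply/seq.permP => r /=; congr (_ + _)%N.
  by congr (count r _); apply: eq_map => f; rewrite precompE.
(* The second partial derivative is symmetric, so phi may be differentiated
   first at a along b, keeping the new variable, and then in the new variable
   along v ∘ a. *)
pose X' := ⟪a ∘ pi0 P, pi1 P⟫ : hom (prd P Z A) _.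
pose Y' := ⟪b ∘ pi0 P, 0⟫ : hom (prd P Z A) (prd P X A).
have -> : dird2 C ⟪a, 0⟫ ⟪b, 0⟫ ⟪0, v ∘ a⟫ phi =
    dird_var C B (idm Z) (v ∘ a) (dird C B X' Y' phi).
  rewrite /dird_var dird_dird !comp_pair -!comp_assoc !pair_pi0 !pair_pi1 !comp_idr comp0.
  by rewrite !dird_pair !(dird_var_pi0 C) dird_pi1 pair_pi1 linear0 pair0 dird0 addr0.
have pX : shift_var C f0 ∘ X' = shift_var C (f0 ∘ a).
  by rewrite (comp_linl C _ _).2 -!comp_assoc pair_pi0 pair_pi1 comp_assoc.
have pS f : f ∘ pi0 P ∘ X' = f ∘ a ∘ pi0 P :> hom _ A.
  by rewrite -!comp_assoc pair_pi0.
have dS f : dird C A X' Y' (f ∘ pi0 P) = dird C A a b f ∘ pi0 P.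
  by rewrite dird_comp dird_pi0 !pair_pi0 dird_comp_r.
have dX : dird C A X' Y' (shift_var C f0) = dird C A a b f0 ∘ pi0 P.
  by rewrite linearD dS dird_pi1 pair_pi1 addr0.
rewrite /phi IHn ?size_map // /dird_var (@dird_shift_like _ _ _ _ _ (v ∘ a)); last first.
  elim: s {sz phi} => [|f s IH].
    rewrite qder0 precompE pX dX; apply: shift_like_br => [|h]; first exact: dird_var_shift.
    by rewrite inE => /eqP->; apply: dird_var_pi0.
  rewrite map_cons -qconsE qder_cons precompE pS dS.
  apply: shift_like_add; apply: shift_like_qcons => //; try exact: dird_var_pi0.
  rewrite qmapE precompE pX; apply: shift_like_br => [|h]; first exact: dird_var_shift.
  by rewrite -map_comp => /mapP[h' _ ->] /=; rewrite precompE pS; apply: dird_var_pi0.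
congr (cdcm _ _ _ (tens g (qcons _ _))); first by rewrite precompE.
rewrite qmap_qder; apply: qder_br_congr => [||f|f] /=;
  rewrite !precompE ?pX ?dX ?pS ?dS ?shift_var_pair0 -?comp_assoc ?pair_pi0 ?comp_idr //.
Qed.

(** Only the base point involves the new variable, so differentiating in that
    variable adjoins an entry to the bracket. *)
Lemma qder_shift_var (X A Z : G) (a : hom Z X) (v : hom Z A) (f0 : hom X A) s :
  qder (precomp C A ⟪a, 0⟫) (dird_var C A a v)
    (br (shift_var C f0) [seq f ∘ pi0 P | f <- s]) =
  br (f0 ∘ a) (rcons [seq f ∘ a | f <- s] v).
Proof.
rewrite qder_const => [|_ /mapP[f _ ->]]; last exact: dird_var_pi0.
rewrite dird_var_shift precompE shift_var_pair0 -map_comp; apply: br_perm.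
rewrite perm_sym perm_rcons perm_cons; apply/seq.permP => r.
by congr (count r _); apply: eq_map => f; rewrite /= precompE -comp_assoc pair_pi0.
Qed.

Lemma qder_shift_var_id (X A : G) (v : hom X A) (f0 : hom X A) s :
  qder (precomp C A ⟪idm X, 0⟫) (dird_var C A (idm X) v)
    (br (shift_var C f0) [seq f ∘ pi0 P | f <- s]) = br f0 (rcons s v).
Proof.
rewrite qder_shift_var comp_idr; congr (br _ (rcons _ _)).
by rewrite -[RHS]map_id; apply: eq_map => f; rewrite comp_idr.
Qed.

End CDCAction.

(** * From derivatives to a composition law on Q *)

Section ToQ.
Context {k : comPzSemiRingType} {G : kgraph k} {P : products G} (C : cdc P).
Local Notation "g ∘ f" := (mcomp C g f) (at level 40, left associativity).
Local Notation "⟪ f , g ⟫" := (mpair C f g).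

(** By induction on the number of entries of s. With none, this is
    functoriality of composition; a further entry of s is a derivative in a new
    variable, and both sides commute with such derivatives by [dird_cdcm] and
    [qsubst_qder]. *)
Lemma cdcm_assoc (X Y Z W : G) (h : hom Z W) (t : Q (hom Y Z)) (s : Q (hom X Y)) :
  cdcm C X Y W (tens (cdcm C Y Z W (tens h t)) s) =
  cdcm C X Z W (tens h (qsubst (cdcm C X Y Z) t s)).
Proof.
move: s; apply: br_klinear_ext => [||f0 s].
- exact: cdcm_klinear.
- exact: (klinear_comp (cdcm_klinear _ _ h) (qsubst_klinearr (cdcm C X Y Z) t)).
have [n] := ubnP (size s); elim: n => // n IHn in X f0 s *.
case/lastP: s => [_|s v].
  rewrite cdcmE derl_nil -precompE cdcm_comp qsubst_br0; congr (cdcm _ _ _ _ (tens h _)).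
  by apply: eq_qmap => g; rewrite precompE /= tensrE cdcmE.
rewrite size_rcons ltnS => sz.
rewrite cdcmE derl_rcons_var -cdcmE IHn ?size_map // /dird_var dird_cdcm.
rewrite -(qsubst_qder (m' := cdcm C X Y Z) (p := precomp C Y ⟪idm X, 0⟫)
  (d := dird_var C Y (idm X) v)) ?qder_shift_var_id //.
- by move=> g u; rewrite cdcm_comp.
- by move=> g u; rewrite -dird_cdcm.
Qed.

(** D-linear maps commute with derivatives, so they also commute with the
    derivative in a new variable that produces each further entry. *)
Lemma derl_postcomp (X A B D : G) (g : hom B D) (h : hom A B) (f0 : hom X A) s :
  Dlinear C g -> derl C (g ∘ h) f0 s = g ∘ derl C h f0 s.
Proof.
move=> gl; have [n] := ubnP (size s); elim: n => // n IHn in X f0 s *.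
case/lastP: s => [_|s v]; first by rewrite !derl_nil comp_assoc.
rewrite size_rcons ltnS => sz.
by rewrite !derl_rcons_var IHn ?size_map // /dird_var dird_comp dirdE gl.
Qed.

Lemma derl_id (X A : G) (f0 : hom X A) s : derl C (idm A) f0 s = counit _ (br f0 s).
Proof.
rewrite counit_br; have [n] := ubnP (size s); elim: n => // n IHn in X f0 s *.
case/lastP: s => [_|s v]; first by rewrite derl_nil comp_idl.
rewrite size_rcons ltnS => sz; rewrite derl_rcons_var IHn ?size_map //.
case: s {sz} => [|x [|y s]] /=; first by rewrite dird_var_shift.
  by rewrite dird_var_pi0.
by rewrite linear0.
Qed.

Lemma cdcm_idl (A B : G) (t : Q (hom A B)) :
  cdcm C A B B (tens (idm B) t) = counit _ t.
Proof.
move: t; apply: br_klinear_ext => [||f0 s]; first exact: cdcm_klinear.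
  exact: linear_klinear.
by rewrite cdcmE derl_id.
Qed.

Lemma cdcm_fusion (X Y Z W : G) (z : hom Z W ⊗ Q (hom Y Z) ⊗ Q (hom X Y)) :
  cdcm C X Y W (tmap (cdcm C Y Z W) idfun z) =
  cdcm C X Z W (tmap idfun (Qmap (cdcm C X Y Z)) (tmap idfun (fusion _ _)
    (tassoc _ _ _ z))).
Proof.
move: z; apply: tens_klinear_ext => [||w s]; try klin.
move: w; apply: tens_klinear_ext => [||h t].
- exact/lin_klinear/lin_klinear/tens_linl.
- exact/lin_klinear/lin_klinear/lin_klinear/lin_klinear/tens_linl.
by rewrite tmapE qsubst_fusion cdcm_assoc.
Qed.

Lemma cdcm_idr (A B : G) (g : hom A B) :
  cdcm C A A B (tens g (br (idm A) [::])) = g.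
Proof. by rewrite cdcmE derl_nil comp_idr. Qed.

Definition cdc_qcat : qcat G := QCat cdcm_fusion cdcm_idl cdcm_idr.

Lemma Dlinear_klinear (X A B : G) (g : hom A B) : Dlinear C g ->
  klinear (fun f : hom X A => g ∘ f).
Proof.
move=> gl; apply: klinear_ext (dird_klinear C (0 : hom X A) g) => f.
by rewrite dirdE gl.
Qed.

Lemma Dlinear_Qlinear (A B : G) (g : hom A B) (gl : Dlinear C g) :
  {q : qlinmap cdc_qcat A B | forall X f, q X f = g ∘ f}.
Proof.
pose q X : {linear hom X A -> hom X B} := slin (Dlinear_klinear X gl).
have qE X f : q X f = g ∘ f by apply: slinE.
suff qm X Y z : q X (qm cdc_qcat z) = qm cdc_qcat (tmap (q Y) idfun z).
  by exists (QLinMap qm).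
move: z; apply: tens_klinear_ext => [||h t]; try klin.
rewrite tmapE; move: t; apply: br_klinear_ext => [||f0 s].
- exact/lin_klinear/cdcm_klinear.
- exact: cdcm_klinear.
by rewrite !qE /= !cdcmE derl_postcomp.
Qed.

Lemma Dlinear_pi0 (A B : G) : Dlinear C (pi0 P : hom (prd P A B) A).
Proof. by move=> Z x v; rewrite -dirdE dird_pi0. Qed.

Lemma Dlinear_pi1 (A B : G) : Dlinear C (pi1 P : hom (prd P A B) B).
Proof. by move=> Z x v; rewrite -dirdE dird_pi1. Qed.

Lemma cdc_cq_one (X : G) (f : hom X (one_ob P)) : f = 0.
Proof. by have [g [_ gu]] := cll_one C X; rewrite -(gu f I) -(gu 0 I). Qed.

Lemma cdc_cq_prod (A B : G) :
  exists (p0 : qlinmap cdc_qcat (prd P A B) A)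
         (p1 : qlinmap cdc_qcat (prd P A B) B),
      [/\ underlying p0 = pi0 P, underlying p1 = pi1 P
        & forall X : G, product_diagram (p0 X) (p1 X)].
Proof.
have [p0 p0E] := Dlinear_Qlinear (@Dlinear_pi0 A B).
have [p1 p1E] := Dlinear_Qlinear (@Dlinear_pi1 A B).
exists p0, p1; rewrite /underlying p0E p1E !comp_idr; split=> // X Z a b.
have hl : klinear (fun z => ⟪a z, b z⟫).
  by split=> [c x|x y]; rewrite ?linearZ ?linearD ?pairZ ?pairD.
exists (lin_of hl); split=> [z|h' h'E z].
  by rewrite p0E p1E lin_ofE pair_pi0 pair_pi1.
have [e0 e1] := h'E z; rewrite lin_ofE.
by apply: pair_uniq; rewrite -?p0E -?p1E.
Qed.

Definition cdc_cqcat : cqcat P := CQCat cdc_cq_one cdc_cq_prod.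

(** A k-Mod^Q-linear family q with underlying map f satisfies
    f • t = q (ε t), because id • t = ε t. For t = ⟨x, v⟩ the left side is
    Df (x, v), and the right side is q v, which is the composite of f and v. *)
Lemma Dlinear_iff_Qlinear (A B : G) (f : hom A B) :
  Dlinear C f <-> Qlinear cdc_cqcat f.
Proof.
split=> [/Dlinear_Qlinear[q qE]|[q qf] Z x v].
  by exists q; rewrite /underlying qE comp_idr.
have qE X (t : Q (hom X A)) : q X (counit _ t) = cdcm C X A B (tens f t).
  by rewrite -cdcm_idl; have := qlin_m q (tens (idm A) t); rewrite tmapE -qf.
have <- : cdcm C Z A B (tens f (br x [:: v])) = diff C f ∘ ⟪x, v⟫.
  by rewrite cdcmE -[[:: v]]/(rcons [::] v) derl_rcons dirdE.
by rewrite -derl_nil -cdcmE -!qE !counit_br.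
Qed.

End ToQ.

(** * From a composition law on Q to derivatives *)

Section ToD.
Context {k : comPzSemiRingType} {G : kgraph k} {P : products G} (M : cqcat P).

Definition qcomp (X Y Z : G) (g : hom Y Z) (f : hom X Y) : hom X Z :=
  qm M (tens g (br f [::])).
Local Notation "g ∘ f" := (qcomp g f) (at level 40, left associativity).
Local Notation "g • t" := (qm M (tens g t)) (at level 40, left associativity).

Lemma qm_subst (X Y Z W : G) (h : hom Z W) (t : Q (hom Y Z)) (s : Q (hom X Y)) :
  h • t • s = h • qsubst (qm M) t s.
Proof. by have := qm_assoc M (tens (tens h t) s); rewrite tmapE qsubst_fusion. Qed.

Lemma qcomp_linl (X Y Z : G) (f : hom X Y) : klinear (fun g : hom Y Z => g ∘ f).
Proof. exact: (lin_klinear (qm M) (tens_linl (br f [::]))). Qed.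

Definition qprecomp (X Y Z : G) (a : hom Z X) : {linear hom X Y -> hom Z Y} :=
  slin (qcomp_linl Y a).

Lemma qprecompE (X Y Z : G) (a : hom Z X) (f : hom X Y) : qprecomp Y a f = f ∘ a.
Proof. exact: slinE. Qed.

(** Composition is the action on brackets without entries. *)
Lemma qm_precomp (X Y Z W : G) (g : hom Y Z) t (a : hom W X) :
  (g • t) ∘ a = g • qmap (qprecomp Y a) t.
Proof.
rewrite /qcomp qm_subst qsubst_br0; congr (_ • _); apply: eq_qmap => f.
by rewrite qprecompE /= tensrE.
Qed.

Lemma qcomp_assoc (X Y Z W : G) (h : hom Z W) (g : hom Y Z) (f : hom X Y) :
  h ∘ (g ∘ f) = h ∘ g ∘ f.
Proof. by rewrite [RHS]qm_precomp qmap0 qprecompE. Qed.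

Lemma qcomp_idl (A B : G) (f : hom A B) : idm B ∘ f = f.
Proof. by rewrite /qcomp qm_idl counit_br. Qed.

Lemma qcomp_idr (A B : G) (f : hom A B) : f ∘ idm A = f.
Proof. exact: qm_idr. Qed.

Definition q_llcat : llcat G := LLCat qcomp_assoc qcomp_idl qcomp_idr qcomp_linl.

Lemma q_one (X : G) : exists! f : hom X (one_ob P), True.
Proof. by exists 0; split=> // f _; rewrite (cq_one M f). Qed.

Lemma qlinmapE (A B X : G) (q : qlinmap M A B) (t : Q (hom X A)) :
  q X (counit _ t) = underlying q • t.
Proof. by have := qlin_m q (tens (idm A) t); rewrite tmapE qm_idl. Qed.

Lemma qlinmap_comp (A B X : G) (q : qlinmap M A B) (h : hom X A) :
  q X h = underlying q ∘ h.
Proof. by rewrite /qcomp -qlinmapE counit_br. Qed.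

(** A k-Mod^Q-linear map only sees the counit of a formal element. *)
Lemma q_pi0 (A B X : G) (t : Q (hom X (prd P A B))) : pi0 P • t = pi0 P ∘ counit _ t.
Proof. by have [p0 [p1 [<- _ _]]] := cq_prod M A B; rewrite -qlinmapE -qlinmap_comp. Qed.

Lemma q_pi1 (A B X : G) (t : Q (hom X (prd P A B))) : pi1 P • t = pi1 P ∘ counit _ t.
Proof. by have [p0 [p1 [_ <- _]]] := cq_prod M A B; rewrite -qlinmapE -qlinmap_comp. Qed.

(** An element of a module is a linear map out of k, so the product diagrams of
    modules give pairings of maps. *)
Lemma q_pair_exists (X A B : G) (f : hom X A) (g : hom X B) :
  exists h : hom X (prd P A B), [/\ pi0 P ∘ h = f, pi1 P ∘ h = g
    & forall h', pi0 P ∘ h' = f -> pi1 P ∘ h' = g -> h' = h].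
Proof.
have [p0 [p1 [e0 e1 pd]]] := cq_prod M A B.
have [h [hE hu]] := pd X k^o (slin (scale_klinear f)) (slin (scale_klinear g)).
have [h0 h1] := hE 1; rewrite !qlinmap_comp e0 e1 !slinE !scale1r in h0 h1.
exists (h 1); split=> // h' h'0 h'1.
rewrite -[LHS]scale1r -(slinE (scale_klinear h')); apply: hu => z.
by rewrite !slinE !linearZ !qlinmap_comp e0 e1 h'0 h'1.
Qed.

Definition qpair (X A B : G) (f : hom X A) (g : hom X B) : hom X (prd P A B) :=
  sval (cid (q_pair_exists f g)).

Lemma qpair_pi0 (X A B : G) (f : hom X A) (g : hom X B) : pi0 P ∘ qpair f g = f.
Proof. by rewrite /qpair; case: cid => h []. Qed.

Lemma qpair_pi1 (X A B : G) (f : hom X A) (g : hom X B) : pi1 P ∘ qpair f g = g.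
Proof. by rewrite /qpair; case: cid => h []. Qed.

Lemma qpair_uniq (X A B : G) (f : hom X A) (g : hom X B) (h : hom X (prd P A B)) :
  pi0 P ∘ h = f -> pi1 P ∘ h = g -> h = qpair f g.
Proof. by rewrite /qpair; case: cid => h' [? ? hu]; apply: hu. Qed.

Lemma qpair_lin (X A B : G) :
  klinear (fun h : hom X (prd P A B) => (pi0 P ∘ h, pi1 P ∘ h)).
Proof.
have [p0 [p1 [<- <- _]]] := cq_prod M A B.
by split=> [c x|x y]; rewrite -!qlinmap_comp ?linearZ ?linearD.
Qed.

Definition q_cllcat : cllcat P :=
  @CLLCat k G P q_llcat q_one qpair qpair_pi0 qpair_pi1 qpair_uniq qpair_lin.

Local Notation "⟪ f , g ⟫" := (qpair f g).

Definition qdiff (A B : G) (f : hom A B) : hom (prd P A A) B :=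
  f • br (pi0 P) [:: pi1 P].

Lemma qdiff_comp_pair (A B Z : G) (f : hom A B) (x v : hom Z A) :
  qdiff f ∘ ⟪x, v⟫ = f • br x [:: v].
Proof. by rewrite qm_precomp qmapE /= !qprecompE qpair_pi0 qpair_pi1. Qed.

Lemma qm_br_klinear (A B Z : G) (f : hom A B) (x : hom Z A) s :
  klinear (fun v => f • br x (v :: s)).
Proof.
apply: lin_klinear.
exact: (klinear_comp (tens_linr f) (br_cons_klinear x s)).
Qed.

(** The derivative of ⟨π0, π1⟩ at (x, r) along (s, v) is ⟨x, r, s⟩ + ⟨x, v⟩. The
    axioms on second derivatives are the cases s = 0, where the first term
    vanishes, and v = 0, where the second vanishes and the first is symmetric in
    r and s. *)
Lemma qdiff_diff (A B Z : G) (f : hom A B) (x r s v : hom Z A) :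
  qdiff (qdiff f) ∘ ⟪⟪x, r⟫, ⟪s, v⟫⟫ = f • br x [:: r; s] + f • br x [:: v].
Proof.
rewrite qdiff_comp_pair qm_subst qsubst_br1 -[br (pi0 P) _]qconsE qder_cons qder0 qmap0.
rewrite /= !tensrE !q_pi0 !q_pi1 !counit_br.
by rewrite !qpair_pi0 !qpair_pi1 (tens_linr _).2 linearD !qconsE.
Qed.

Lemma q_diff_axioms : diff_axioms q_cllcat qdiff.
Proof.
split=> /=.
- move=> A B; exact: (lin_klinear (qm M) (tens_linl _)).
- move=> A B Z f x v w l m; rewrite !qdiff_comp_pair.
  by have [lZ lD] := qm_br_klinear f x [::]; rewrite lD !lZ.
- by move=> A0 A1; rewrite /qdiff q_pi0 counit_br.
- by move=> A0 A1; rewrite /qdiff q_pi1 counit_br.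
- by move=> A; rewrite /qdiff qm_idl counit_br.
- move=> A B C g f; rewrite qdiff_comp_pair /qdiff /qcomp qm_subst qsubst0_br.
  by rewrite -qconsE qdup_cons qdup0 qder0 qmapE /= !tenslE qconsE.
- move=> A B Z f x r v; rewrite qdiff_diff qdiff_comp_pair.
  have [lZ _] := qm_br_klinear f x [:: r].
  rewrite (br_perm _ (_ : perm_eq [:: r; 0] [:: 0; r])) //; last first.
    by rewrite (perm_catCA [:: r] [:: 0] [::]).
  by rewrite (klinear_eq0 (qm_br_klinear f x [:: r])) add0r.
- move=> A B Z f x r s; rewrite !qdiff_diff.
  by rewrite (br_perm _ (_ : perm_eq [:: r; s] [:: s; r])) //
    (perm_catCA [:: r] [:: s] [::]).
Qed.

Definition q_cdc : cdc P := CDC q_diff_axioms.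

(** Both composition laws turn a derivative in a new variable into the
    operator [qder] on formal elements, so they agree by induction on the
    number of entries. *)
Lemma q_cdcmE (X Y Z : G) z : cdcm q_cdc X Y Z z = qm M z.
Proof.
move: z; apply: tens_klinear_ext => [||g t]; try klin.
move: t; apply: br_klinear_ext => [||f0 s].
- exact: cdcm_klinear.
- exact/lin_klinear/tens_linr.
have [n] := ubnP (size s); elim: n => // n IHn in X f0 s *.
case/lastP: s => [_|s v]; first by rewrite cdcmE derl_nil.
rewrite size_rcons ltnS => sz.
rewrite cdcmE derl_rcons_var -cdcmE IHn ?size_map // /dird_var dirdE.
rewrite [LHS]qdiff_comp_pair qm_subst qsubst_br1 -(qder_shift_var_id q_cdc).
congr (_ • _); apply: eq_qder => h.
  by rewrite precompE /= tensrE.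
by rewrite /dird_var dirdE [RHS]qdiff_comp_pair /= tensrE.
Qed.

End ToD.

(** * Uniqueness and the equivalence *)

Lemma linear_eqP (k : comPzSemiRingType) (U V : lSemiModType k) (f g : {linear U -> V}) :
  f =1 g -> f = g.
Proof.
case: f => f [cf1 cf2]; case: g => g [cg1 cg2] /= fg.
have e : f = g by apply: funext.
case: _ / e cg1 cg2 {fg} => cg1 cg2.
have -> : cf1 = cg1.
  case: cf1 => [[a b]]; case: cg1 => [[a' b']].
  by rewrite (Prop_irrelevance a a') (Prop_irrelevance b b').
have -> // : cf2 = cg2.
by case: cf2 => a; case: cg2 => a'; rewrite (Prop_irrelevance a a').
Qed.

Section Equality.
Context {k : comPzSemiRingType} {G : kgraph k} {P : products G}.

Lemma llcat_eq (L L' : llcat G) :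
  (forall A B C (g : hom B C) (f : hom A B), mcomp L g f = mcomp L' g f) -> L = L'.
Proof.
case: L => c a il ir l; case: L' => c' a' il' ir' l' /= cc'.
have e : c = c'.
  by do 5 apply: functional_extensionality_dep => ?; apply: cc'.
case: _ / e a' il' ir' l' {cc'} => a' il' ir' l'.
by congr LLCat; apply: Prop_irrelevance.
Qed.

(** Pairing is determined by composition. *)
Lemma cllcat_eq (L L' : cllcat P) :
  (forall A B C (g : hom B C) (f : hom A B), mcomp L g f = mcomp L' g f) -> L = L'.
Proof.
case: L => c o p p0 p1 pu pl; case: L' => c' o' p' p0' p1' pu' pl' /= cc'.
have e := llcat_eq cc'; case: _ / e o' p' p0' p1' pu' pl' {cc'} => o' p' p0' p1' pu' pl'.
have e : p = p'.
  by do 5 apply: functional_extensionality_dep => ?; apply: pu'; rewrite ?p0 ?p1.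
case: _ / e p0' p1' pu' => p0' p1' pu'.
by rewrite (Prop_irrelevance o' o) (Prop_irrelevance p0' p0)
  (Prop_irrelevance p1' p1) (Prop_irrelevance pu' pu) (Prop_irrelevance pl' pl).
Qed.

Lemma cdc_eq (C C' : cdc P) :
  (forall A B D (g : hom B D) (f : hom A B), mcomp C g f = mcomp C' g f) ->
  (forall A B (f : hom A B), diff C f = diff C' f) -> C = C'.
Proof.
case: C => c d dP; case: C' => c' d' dP' /= /cllcat_eq e; case: _ / e dP' => dP' dd'.
have e : d = d' by do 3 apply: functional_extensionality_dep => ?; apply: dd'.
by case: _ / e dP' {dd'} => dP'; congr CDC; apply: Prop_irrelevance.
Qed.

Lemma qcat_eq (M M' : qcat G) :
  (forall A B C z, @qm _ _ M A B C z = @qm _ _ M' A B C z) -> M = M'.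
Proof.
case: M => m a il ir; case: M' => m' a' il' ir' /= mm'.
have e : m = m'.
  by do 3 apply: functional_extensionality_dep => ?; apply/linear_eqP/mm'.
case: _ / e a' il' ir' {mm'} => a' il' ir'.
by congr QCat; apply: Prop_irrelevance.
Qed.

Lemma cqcat_eq (M M' : cqcat P) :
  (forall A B C z, @qm _ _ M A B C z = @qm _ _ M' A B C z) -> M = M'.
Proof.
case: M => m o p; case: M' => m' o' p' /= /qcat_eq e.
by case: _ / e p' => p'; congr CQCat; apply: Prop_irrelevance.
Qed.

End Equality.

Theorem theorem6p4 (k : comPzSemiRingType) (G : kgraph k) (P : products G) :
  exists (toQ : cdc P -> cqcat P) (toD : cqcat P -> cdc P),
    [/\ (forall (C : cdc P) (X Y Z : G) (g : hom Y Z) (f0 : hom X Y)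
             (fs : seq (hom X Y)),
           qm (toQ C) (tens g (br f0 fs)) =
           mcomp C (der C g (size fs)) (tup C (size fs) (nth 0 (f0 :: fs)))),
        (forall (M : cqcat P) (X Y Z : G) (g : hom Y Z) (f : hom X Y),
           mcomp (toD M) g f = qm M (tens g (br f [::]))) /\
        (forall (M : cqcat P) (X Y : G) (f : hom X Y),
           diff (toD M) f = qm M (tens f (br (pi0 P) [:: pi1 P]))),
        cancel toQ toD,
        cancel toD toQ
      & forall (C : cdc P) (X Y : G) (f : hom X Y),
          Dlinear C f <-> Qlinear (toQ C) f].
Proof.
exists cdc_cqcat, q_cdc; split.
- move=> C X Y Z g f0 fs; exact: cdcmE.
- by [].
- move=> C; apply: cdc_eq => [X Y Z g f|X Y f]; first exact: cdcmE.
  rewrite [LHS]cdcmE -[[:: pi1 P]]/(rcons [::] _) derl_rcons /= dirdE pair_id.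
  exact: comp_idr.
- move=> M; apply: cqcat_eq => X Y Z z; exact: q_cdcmE.
- move=> C X Y f; exact: Dlinear_iff_Qlinear.
Qed.
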